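(* Let $\mathsf{k}$ be a field, let $X$ be an $n \times n$ matrix of indeterminates over $\mathsf{k}$, and let $R$ be the determinantal ring $\mathsf{k}[X]/(\det(X))$. Then the isomorphism classes in the divisor class group $\operatorname{Cl}(R)$ of $R$ are exactly those of the $1$-semidualizing modules of $R$; that is, a finitely generated $R$-module $C$ is $1$-semidualizing if and only if $[C] \in \operatorname{Cl}(R)$.
   Context: All rings are commutative and noetherian. A finitely generated $R$-module $C$ is $n$-semidualizing ($n \in \mathbb{N}=\{0,1,2,\dots\}$) if $\operatorname{Hom}_R(C,C) \cong R$ and $\operatorname{Ext}_R^i(C,C)=0$ for all $0<i\leq n$. So $C$ is $1$-semidualizing if $\operatorname{Hom}_R(C,C)\cong R$ and $\operatorname{Ext}^1_R(C,C)=0$. $\mathsf{k}[X]$ denotes the polynomial ring over $\mathsf{k}$ in the entries of $X$. The ring $R$ is a normal domain. For a normal domain $R$, put $(-)^*=\operatorname{Hom}_R(-,R)$; a finitely generated $R$-module $M$ is reflexive if $M \cong M^{**}$. The divisor class group $\operatorname{Cl}(R)$ is the set of isomorphism classes $[M]$ of reflexive $R$-modules $M$ of rank $1$, with additive identity $[R]$ and operations $[M]+[N]=[(M\otimes_R N)^{**}]$ and $[M]-[N]=[\operatorname{Hom}_R(N,M)]$. *)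

(* Defs.v *)
(* MathComp, with the classical axioms of mathcomp.classical.boolp. *)
From HB Require Import structures.
From mathcomp Require Import all_boot all_algebra.
From mathcomp Require Import boolp.
From mathcomp Require Import mpoly.

Set Implicit Arguments.
Unset Strict Implicit.
Unset Printing Implicit Defensive.

Import GRing.Theory.
Local Open Scope ring_scope.

Definition generic_mx (k : fieldType) (n : nat) : 'M[{mpoly k[n * n]}]_n :=
  \matrix_(i, j) 'X_(mxvec_index i j).

(* The ideal generated by det X.  The quotient {ideal_quot _} of MathComp asks
   for a provably proper ideal, hence the argument n_gt0 (for n = 0, det X = 1);
   the ideal does not otherwise depend on it. *)
Definition det_ideal (k : fieldType) (n : nat) (n_gt0 : (0 < n)%N) :
    {pred {mpoly k[n * n]}} :=
  fun p => `[< exists q, p = q * \det (generic_mx k n) >].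
Arguments det_ideal k {n} n_gt0 _.

Lemma det_ideal_closed (k : fieldType) (n : nat) (n_gt0 : (0 < n)%N) :
  idealr_closed (det_ideal k n_gt0).
Proof.
split.
- by apply/asboolP; exists 0; rewrite mul0r.
- apply/negP => /asboolP[q /(congr1 (meval (fun=> 0)))].
  rewrite rmorphM rmorph1 /= -det_map_mx.
  have -> : map_mx (meval (fun=> 0)) (generic_mx k n) = 0.
    by apply/matrixP => i j; rewrite !mxE mevalXU.
  case: n n_gt0 q => // m _ q; rewrite det0 mulr0.
  by move/eqP; rewrite oner_eq0.
- move=> a u v /asboolP[p ->] /asboolP[q ->]; apply/asboolP.
  by exists (a * p + q); rewrite mulrDl mulrA.
Qed.

HB.instance Definition _ (k : fieldType) (n : nat) (n_gt0 : (0 < n)%N) :=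
  isIdealr.Build _ (det_ideal k n_gt0 : _ -> bool) (@det_ideal_closed k n n_gt0).

Definition det_ring (k : fieldType) (n : nat) (n_gt0 : (0 < n)%N)
    : comNzRingType :=
  {ideal_quot (det_ideal k n_gt0 : idealr _)}.

(* Hom_R(U, V) with its R-module structure; the carrier is {linear U -> V}. *)
Definition Hom (R : comNzRingType) (U V : lmodType R) : Type :=
  {linear U -> V}.

Section HomModule.
Variables (R : comNzRingType) (U V : lmodType R).
Implicit Types f g h : {linear U -> V}.

Lemma Hom_eqP f g : f =1 g -> f = g :> Hom U V.
Proof.
case: f g => [f [[fD] [fZ]]] [g [[gD] [gZ]]] /= /funext fg.
case: g / fg gD gZ => gD gZ.
by rewrite (Prop_irrelevance gD fD) (Prop_irrelevance gZ fZ).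
Qed.

HB.instance Definition _ := gen_eqMixin (Hom U V).
HB.instance Definition _ := gen_choiceMixin (Hom U V).

Definition Hom_zero : Hom U V := [the {linear U -> V} of \0].
Definition Hom_opp f : Hom U V := [the {linear U -> V} of \- f].
Definition Hom_add f g : Hom U V := [the {linear U -> V} of f \+ g].
Definition Hom_scale (a : R) f : Hom U V := [the {linear U -> V} of a \*: f].

Fact Hom_addA : associative (Hom_add : Hom U V -> Hom U V -> Hom U V).
Proof. by move=> f g h; apply: Hom_eqP => x /=; rewrite addrA. Qed.
Fact Hom_addC : commutative (Hom_add : Hom U V -> Hom U V -> Hom U V).
Proof. by move=> f g; apply: Hom_eqP => x /=; rewrite addrC. Qed.
Fact Hom_add0 : left_id Hom_zero (Hom_add : Hom U V -> Hom U V -> Hom U V).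
Proof. by move=> f; apply: Hom_eqP => x /=; rewrite add0r. Qed.
Fact Hom_addN :
  left_inverse Hom_zero (Hom_opp : Hom U V -> Hom U V) Hom_add.
Proof. by move=> f; apply: Hom_eqP => x /=; rewrite addNr. Qed.

HB.instance Definition _ :=
  GRing.isZmodule.Build (Hom U V) Hom_addA Hom_addC Hom_add0 Hom_addN.

Fact Hom_scaleA (a b : R) (f : Hom U V) :
  Hom_scale a (Hom_scale b f) = Hom_scale (a * b) f.
Proof. by apply: Hom_eqP => x /=; rewrite scalerA. Qed.
Fact Hom_scale1 : left_id (1 : R) (Hom_scale : R -> Hom U V -> Hom U V).
Proof. by move=> f; apply: Hom_eqP => x /=; rewrite scale1r. Qed.
Fact Hom_scaleDr :
  right_distributive (Hom_scale : R -> Hom U V -> Hom U V) +%R.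
Proof. by move=> a f g; apply: Hom_eqP => x /=; rewrite scalerDr. Qed.
Fact Hom_scaleDl (f : Hom U V) :
  {morph (fun a : R => Hom_scale a f : Hom U V) : a b / a + b}.
Proof. by move=> a b; apply: Hom_eqP => x /=; rewrite scalerDl. Qed.

HB.instance Definition _ := GRing.Zmodule_isLmodule.Build R (Hom U V)
  Hom_scaleA Hom_scale1 Hom_scaleDr Hom_scaleDl.

End HomModule.

Section Modules.
Variable R : comNzRingType.
Implicit Types M N C : lmodType R.

Definition isomorphic M N : Prop := exists f : {linear M -> N}, bijective f.

Definition finitely_generated M : Prop :=
  exists (m : nat) (g : 'I_m -> M),
    forall x : M, exists a : 'I_m -> R, x = \sum_i a i *: g i.

Definition surjective (S T : Type) (f : S -> T) : Prop :=
  forall y, exists x, f x = y.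

Definition projective_module (P : lmodType R) : Prop :=
  forall (M N : lmodType R) (p : {linear M -> N}) (f : {linear P -> N}),
    surjective p -> exists g : {linear P -> M}, forall x, p (g x) = f x.

(* ... -> P 2 -> P 1 -> P 0 -> M -> 0 exact, with all P i projective *)
Record projective_resolution M := ProjectiveResolution {
  res_obj :> nat -> lmodType R;
  res_d : forall i, {linear res_obj i.+1 -> res_obj i};
  res_aug : {linear res_obj 0%N -> M};
  res_proj : forall i, projective_module (res_obj i);
  res_aug_surj : surjective res_aug;
  res_exact0 : forall x, res_aug x = 0 <-> exists y, res_d 0%N y = x;
  res_exact : forall i x, res_d i x = 0 <-> exists y, res_d i.+1 y = x
}.

(* cocycles and coboundaries of 0 -> Hom(P 0, N) -> Hom(P 1, N) -> ... *)
Definition cocycle M N (P : projective_resolution M) (i : nat)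
    (f : {linear P i -> N}) : Prop :=
  forall x, f (res_d P i x) = 0.

Definition coboundary M N (P : projective_resolution M) (i : nat) :
    {linear P i -> N} -> Prop :=
  match i with
  | 0 => fun f => forall x, f x = 0
  | j.+1 => fun f =>
      exists g : {linear P j -> N}, forall x, f x = g (res_d P j x)
  end.

(* Ext^i_R(M, N) = 0, i.e., H^i(Hom(P, N)) = 0; as every module has a
   projective resolution P and the cohomology does not depend on it, we ask
   this for all of them. *)
Definition Ext_eq0 (i : nat) M N : Prop :=
  forall (P : projective_resolution M) (f : {linear P i -> N}),
    cocycle f -> coboundary f.

Definition semidualizing (n : nat) C : Prop :=
  [/\ finitely_generated C,
      isomorphic (Hom C C) R^o
    & forall i : nat, (0 < i <= n)%N -> Ext_eq0 i C C].

Definition dual_module M : lmodType R := Hom M R^o.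

Definition reflexive_module M : Prop :=
  finitely_generated M /\ isomorphic M (dual_module (dual_module M)).

Definition linearly_independent M (m : nat) (v : 'I_m -> M) : Prop :=
  forall a : 'I_m -> R, \sum_i a i *: v i = 0 -> forall i, a i = 0.

(* For R a domain: the rank is the maximal number of linearly independent
   elements of M. *)
Definition has_rank M (r : nat) : Prop :=
  (exists v : 'I_r -> M, linearly_independent v) /\
  (forall m (v : 'I_m -> M), linearly_independent v -> (m <= r)%N).

Definition iso_class M : lmodType R -> Prop := fun N => isomorphic M N.

(* The underlying set of the divisor class group, as a set of classes. *)
Definition Cl (c : lmodType R -> Prop) : Prop :=
  exists M, [/\ reflexive_module M, has_rank M 1 & c = iso_class M].

End Modules.

(* Main.v *)
From HB Require Import structures.
From mathcomp Require Import freeg.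
From mathcomp Require Import all_boot all_algebra.
From mathcomp Require Import fingroup perm boolp ring zify mpoly.
Require Import Defs.

(** Write R = S / (det X) with S = k[X].  Let w be one of the minors of size n - 1 obtained by
    deleting row i and column j.  Since det X is linear in the variable x_ij with coefficient
    +-w, inverting w in R eliminates x_ij: R[1/w] is a localization of a polynomial ring over k,
    hence factorial.  Moreover the corner minors w1, w2 (delete row 1 and column n, or row n and
    column 1) and the sum v of the c-th powers of the principal minors form a regular sequence on
    R, even after raising w1 and w2 to powers.  This is read off the leading forms for a weight
    that prefers entries near the diagonal: for det X, w1, w2 and v these are prod x_ii,
    prod x_(i+1,i), prod x_(i,i+1) and the sum over i of prod_(l <> i) x_ll^c.

    A reflexive module C of rank 1 is free of rank 1 after inverting any of these minors, and
    w1, w2 being regular forces End(C) = R.  A self-extension of C becomes trivial after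
    multiplication by some d = w1^a; the obstruction to dividing by d is a map C -> C / dC, which
    is a scalar locally at each minor, and the local scalars glue because d, w2^b, v form a
    regular sequence.  Hence Ext^1(C, C) = 0.

    Conversely let End(C) = R and Ext^1(C, C) = 0.  As C is faithful and finitely generated, it
    has a nonzero map to L for every nonzero L that contains a copy of R / p with p prime.  If C
    had torsion, or rank at least 2, such maps would give endomorphisms that are not scalars.  If
    C were not its bidual C'', a nonzero map C -> C'' / C would lift to C -> C'' because the Ext
    module vanishes; but Hom(C, C'') = R. *)

Set Implicit Arguments.
Unset Strict Implicit.
Unset Printing Implicit Defensive.

Import GRing.Theory.
Local Open Scope ring_scope.

(** * Unique factorization in polynomial rings *)

Definition divides (A : comNzRingType) (a b : A) := exists c, b = c * a.

Section Divides.
Variable A : comNzRingType.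
Implicit Types a b c x : A.

Lemma dividesxx a : divides a a. Proof. by exists 1; rewrite mul1r. Qed.
Lemma divides0 a : divides a 0. Proof. by exists 0; rewrite mul0r. Qed.
Lemma divides_trans b a c : divides a b -> divides b c -> divides a c.
Proof. by case=> x -> [y ->]; exists (y * x); rewrite mulrA. Qed.
Lemma divides_mull x a b : divides a b -> divides a (x * b).
Proof. by case=> c ->; exists (x * c); rewrite mulrA. Qed.
Lemma divides_mulr x a b : divides a b -> divides a (b * x).
Proof. by rewrite mulrC; apply: divides_mull. Qed.
Lemma dividesD a b c : divides a b -> divides a c -> divides a (b + c).
Proof. by case=> x -> [y ->]; exists (x + y); rewrite mulrDl. Qed.
Lemma dividesB a b c : divides a b -> divides a c -> divides a (b - c).
Proof. by case=> x -> [y ->]; exists (x - y); rewrite mulrBl. Qed.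
End Divides.

Section Primes.
Variable A : idomainType.
Implicit Types a b c p q x u : A.
Implicit Types s : seq A.

Lemma divides_pmul2l c a b : c != 0 -> divides (c * a) (c * b) -> divides a b.
Proof.
move=> c0 [x e]; exists x; apply: (mulfI c0); rewrite e; ring.
Qed.

Definition is_prime p : Prop :=
  [/\ p != 0, ~ divides p 1
    & forall a b, divides p (a * b) -> divides p a \/ divides p b].

Definition primes_seq s : Prop := {in s, forall p, is_prime p}.

(** The factors are primes rather than irreducibles, so uniqueness is automatic. *)
Definition ufd : Prop :=
  forall a, a != 0 -> exists u s,
    [/\ divides u 1, primes_seq s & a = u * \prod_(p <- s) p].

Lemma primes_seq_cons p s : primes_seq (p :: s) <-> is_prime p /\ primes_seq s.
Proof.
split=> [H|[Hp Hs] q]; last by rewrite inE => /predU1P[->|/Hs].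
split=> [|q qs]; apply: H; first exact: mem_head.
by rewrite inE qs orbT.
Qed.

Lemma prime_dvd_prod q s : is_prime q -> primes_seq s ->
  divides q (\prod_(p <- s) p) ->
  exists v s', [/\ divides v 1, primes_seq s', (size s' < size s)%N
    & \prod_(p <- s) p = q * (v * \prod_(p <- s') p)].
Proof.
move=> [q0 qN1 qP]; elim: s => [|p s IH]; first by rewrite big_nil.
move=> /primes_seq_cons[[p0 pN1 pP] sP]; rewrite big_cons => /qP[].
  case=> c pE; have := dividesxx p; rewrite {2}pE => /pP[] [d dE].
    exists c, s; split=> //.
      exists q; apply: (mulfI p0); rewrite mulr1 {1}pE dE.
      case: (boolP (d == 0)) => [/eqP d0|d0].
        by move: p0; rewrite pE dE d0 !mul0r eqxx.
      have e : q * d = 1.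
        by apply: (mulfI p0); rewrite mulr1 {2}pE dE; ring.
      by case: qN1; exists d; rewrite mulrC e.
    by rewrite pE; ring.
  exists c, s; split=> //; last by rewrite pE; ring.
  exists d; apply: (mulfI q0); rewrite mulr1 {1}dE.
  by rewrite {1}pE; ring.
move=> /(IH sP)[v [s' [v1 s'P ss' E]]].
exists v, (p :: s'); split=> //; first by apply/primes_seq_cons.
by rewrite E big_cons; ring.
Qed.

(** The colon ideal [(b) : a] is principal, generated by [b / gcd(a, b)]. The prime factors of [b]
    are removed one at a time: one that divides [a] cancels, one that does not must divide [x]. *)
Lemma ufd_colon a b : ufd -> b != 0 ->
  exists l, forall x, divides b (x * a) <-> divides l x.
Proof.
move=> U /U[u [s [[v uv] sP ->]]] {b}.
suff [l H] : exists l, forall x,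
    divides (\prod_(p <- s) p) (x * a) <-> divides l x.
  exists l => x; rewrite -H; split=> [[c ->]|[c ->]].
    by exists (c * u); ring.
  by exists (c * v); rewrite -[LHS]mulr1 uv; ring.
elim: s sP a => [|p s IH] sP a.
  exists 1 => x; rewrite big_nil.
  by split=> _; [exists x | exists (x * a)]; rewrite mulr1.
case/primes_seq_cons: sP => -[p0 _ pP] sP; rewrite big_cons.
have [[c ->]|pa] := pselect (divides p a).
  have [l H] := IH sP c; exists l => x; rewrite -H; split=> [|[d]].
    by rewrite mulrA (mulrC _ p); apply: divides_pmul2l.
  by move=> e; exists d; rewrite mulrA e; ring.
have [l H] := IH sP a; exists (p * l) => x; split.
  move=> D; have /pP[] // : divides p (x * a).
    by apply: divides_trans D; exists (\prod_(j <- s) j); ring.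
  case=> y xE; have /H[z zE] : divides (\prod_(p <- s) p) (y * a).
    by apply: (@divides_pmul2l p) => //; move: D; rewrite xE; congr divides; ring.
  by exists z; rewrite xE zE; ring.
case=> y ->; have /H[z zE] : divides l (y * l) by exists y.
by exists z; transitivity (p * (y * l * a)); [ring | rewrite zE; ring].
Qed.
End Primes.

(** * Gauss's lemma and factorization over a factorial domain *)

Section PolyPrimes.
Variable A : idomainType.
Implicit Types (f g h : {poly A}) (c p : A).

Lemma divides_polyC c f : divides c%:P f <-> forall i, divides c f`_i.
Proof.
split=> [[q ->] i|H]; first by exists q`_i; rewrite coefMC.
have /choice[q qE] : forall i : nat, exists d, f`_i = d * c by [].
exists (\poly_(i < size f) q i); apply/polyP=> i; rewrite coefMC coef_poly.
by case: ltnP => [_|ge]; [apply: qE | rewrite mul0r nth_default].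
Qed.

Lemma size_sub_lead f : f != 0 ->
  (size (f - lead_coef f *: 'X^((size f).-1))%R < size f)%N.
Proof.
move=> f0; have sf : (0 < size f)%N by rewrite size_poly_gt0.
rewrite -[X in (_ < X)%N](prednK sf) ltnS; apply/leq_sizeP => j le_j.
rewrite coefB coefZ coefXn; have [->|ne] := eqVneq j (size f).-1.
  by rewrite mulr1 subrr.
rewrite mulr0 subr0 nth_default // -(prednK sf).
by rewrite ltn_neqAle eq_sym ne.
Qed.

(** Induction on the sizes: [p] divides one of the two leading coefficients, and removing that
    leading term keeps the product divisible by [p]. *)
Lemma prime_polyC p : is_prime p -> is_prime p%:P.
Proof.
move=> [p0 pN1 pP]; split; first by rewrite polyC_eq0.
  by move=> /divides_polyC/(_ 0%N); rewrite coef1.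
move=> f g; have [n] := ubnP (size f + size g)%N.
elim: n f g => // n IH f g lt_n D.
have [->|f0] := eqVneq f 0; first by left; apply: divides0.
have [->|g0] := eqVneq g 0; first by right; apply: divides0.
have key h1 h2 : h1 != 0 -> divides p%:P (h1 * h2) -> divides p (lead_coef h1) ->
    (size h1 + size h2 <= n)%N -> divides p%:P h1 \/ divides p%:P h2.
  move=> h0 D1 D2 le_n.
  have D3 : divides p%:P (lead_coef h1 *: 'X^((size h1).-1)).
    by apply/divides_polyC => i; rewrite coefZ; apply: divides_mulr.
  have [|||] // := IH (h1 - lead_coef h1 *: 'X^((size h1).-1)) h2.
  - by apply: leq_trans le_n; rewrite ltn_add2r size_sub_lead.
  - by rewrite mulrBl; apply: dividesB => //; apply: divides_mulr.
  - move=> D4; left; rewrite -[h1](subrK (lead_coef h1 *: 'X^((size h1).-1))).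
    exact: dividesD.
  - by right.
have /divides_polyC/(_ (size (f * g)).-1) := D.
rewrite -lead_coefE lead_coefM => /pP[] D2; first exact: key.
by apply/or_comm/key => //; rewrite 1?mulrC 1?addnC.
Qed.

(** For nonzero [f] over a factorial domain, this is primitivity. *)
Definition no_const_prime f := forall p, is_prime p -> ~ divides p%:P f.

Lemma no_const_primeMl f g : no_const_prime (f * g) -> no_const_prime f.
Proof. by move=> H p /H N D; apply: N; apply: divides_mulr. Qed.

Lemma no_const_primeMr f g : no_const_prime (f * g) -> no_const_prime g.
Proof. by rewrite mulrC; apply: no_const_primeMl. Qed.

Hypothesis U : ufd A.

(** Each constant prime taken out of [f] is also taken out of a product of primes that the leading
    coefficient divides, so the process stops. *)
Lemma content_split f : f != 0 ->
  exists c g, [/\ c != 0, f = c%:P * g & no_const_prime g].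
Proof.
move=> f0.
have [u [s [u1 sP lE]]] : exists u s,
    [/\ divides u 1, primes_seq s & lead_coef f = u * \prod_(p <- s) p].
  by apply: U; rewrite lead_coef_eq0.
have {lE u1} D : divides (lead_coef f) (\prod_(p <- s) p).
  case: u1 => v vu; exists v; rewrite lE mulrA -vu mul1r //.
have [n] := ubnP (size s).
elim: n f f0 s sP D {u} => // n IH f f0 s sP D lt_n.
have [[q [qp [g fE]]]|N] := pselect (exists q, is_prime q /\ divides q%:P f); last first.
  exists 1, f; split; rewrite ?oner_eq0 ?mul1r // => p pp Dp.
  by apply: N; exists p.
have g0 : g != 0 by apply: contraNneq f0 => g0; rewrite fE g0 mul0r.
have lE : lead_coef f = lead_coef g * q by rewrite fE lead_coefM lead_coefC.
have [v [s' [[v' v1] s'P lts E]]] : exists v s',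
    [/\ divides v 1, primes_seq s', (size s' < size s)%N
    & \prod_(p <- s) p = q * (v * \prod_(p <- s') p)].
  apply: prime_dvd_prod => //; apply: divides_trans D.
  by exists (lead_coef g).
have [||c [h [c0 gE hP]]] := IH g g0 s' s'P.
- case: D => d; rewrite E lE => dE; exists (v' * d).
  have [q0 _ _] := qp; apply: (mulfI q0); rewrite -[LHS]mul1r [X in X * _ = _]v1.
  by transitivity (v' * (q * (v * \prod_(p <- s') p))); [ring | rewrite dE; ring].
- exact: leq_trans lts _.
exists (c * q), h; split=> //; last by rewrite fE gE polyCM; ring.
by case: qp => q0 _ _; rewrite mulf_neq0.
Qed.

Lemma gauss_divides c f g : c != 0 -> no_const_prime g ->
  divides c%:P (f * g) -> divides c%:P f.
Proof.
move=> c0 gP; have [u [s [[v u1] sP ->]]] := U c0 => {c c0}.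
elim: s sP f => [|p s IH] sP f.
  by move=> _; rewrite big_nil mulr1; exists (f * v%:P); rewrite -mulrA -polyCM -u1 mulr1.
case/primes_seq_cons: sP => pp sP; rewrite big_cons => D.
have [p0 _ _] := pp.
have pC0 : p%:P != 0 by rewrite polyC_eq0.
have [_ _ pP] := prime_polyC pp.
have : divides p%:P (f * g).
  apply: divides_trans D; exists (u * \prod_(j <- s) j)%:P.
  by rewrite -polyCM; congr _%:P; ring.
case/pP => [[h fE]|/(gP _ pp)//].
have : divides (u * \prod_(j <- s) j)%:P (h * g).
  case: D => d dE; exists d; apply: (mulfI pC0); move: dE; rewrite fE !polyCM => dE.
  by transitivity (h * p%:P * g); [ring | rewrite dE; ring].
case/(IH sP) => d hE; exists d; rewrite fE hE !polyCM; ring.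
Qed.

Lemma no_const_prime_size1 g : g != 0 -> no_const_prime g -> (size g <= 1)%N ->
  divides g 1.
Proof.
move=> g0 gP /size1_polyC gE; move: g0; rewrite gE polyC_eq0 => c0.
have [u [s [[v u1] sP cE]]] := U c0.
case: s sP cE => [_ ->|p s /primes_seq_cons[pp _] cE].
  by rewrite big_nil mulr1; exists v%:P; rewrite -polyCM -u1.
case: (gP p pp); rewrite gE cE big_cons; exists (u * \prod_(j <- s) j)%:P.
by rewrite -polyCM; congr _%:P; ring.
Qed.

(** The relation [%|] is divisibility over the fraction field; for a primitive divisor it is true
    divisibility ([pull]). So, unless [g] is coprime to [f], the primitive part of their gcd is an
    associate of [g]. *)
Lemma irreducible_prime g : (1 < size g)%N -> no_const_prime g ->
  (forall a b, g = a * b -> size a = 1%N \/ size b = 1%N) -> is_prime g.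
Proof.
move=> sg gP irr.
have g0 : g != 0 by rewrite -size_poly_gt0 ltnW.
have pull f h : no_const_prime h -> h %| f -> divides h f.
  move=> hP /Pdiv.Idomain.dvdpP[[c q] /= c0 E].
  have : divides c%:P (q * h) by rewrite -E; exists f; rewrite mulrC mul_polyC.
  case/(gauss_divides c0 hP) => r qE; exists r.
  have cC0 : c%:P != 0 by rewrite polyC_eq0.
  by apply: (mulfI cC0); rewrite mul_polyC E qE; ring.
split=> //.
  case=> c E; have: size (1 : {poly A}) = 1%N by rewrite size_poly1.
  rewrite E size_mul //; last first.
    by apply/eqP=> c0; move/eqP: E; rewrite c0 mul0r oner_eq0.
  have : (0 < size c)%N.
    by rewrite size_poly_gt0; apply/eqP=> c0; move/eqP: E; rewrite c0 mul0r oner_eq0.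
  by move: sg; case: (size c) => [|a]; case: (size g) => [|[|b]] // _ _; rewrite addSn !addnS.
move=> f h D.
have Dp : g %| f * h.
  by case: D => q ->; apply: dvdp_mull.
case: (boolP (coprimep g f)) => [co|].
  by right; apply: pull => //; rewrite -(Gauss_dvdpr _ co).
rewrite coprimep_def => sd; left.
have d0 : gcdp g f != 0 by rewrite gcdp_eq0 (negPf g0).
have [c [d [c0 dE dP]]] := content_split d0.
have sdE : size d = size (gcdp g f).
  by rewrite dE size_Cmul.
have Dg : divides d g.
  by apply: pull => //; apply: dvdp_trans (dvdp_gcdl g f); rewrite dE dvdp_mull.
have Df : divides d f.
  by apply: pull => //; apply: dvdp_trans (dvdp_gcdr g f); rewrite dE dvdp_mull.
case: Dg => e gE; have [se|se] := irr _ _ gE; last by rewrite -sdE se in sd.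
have e0 : e != 0 by rewrite -size_poly_gt0 se.
have [e' e'E] : divides e 1.
  by apply: no_const_prime_size1; rewrite ?se //; apply: (@no_const_primeMl e d); rewrite -gE.
apply: divides_trans Df; exists e'.
by rewrite gE mulrA -e'E mul1r.
Qed.

(** The content factors in [A]; the primitive part is split into factors of smaller degree until
    these are irreducible. *)
Lemma ufd_poly : ufd {poly A}.
Proof.
have prim n : forall g, (size g < n)%N -> g != 0 -> no_const_prime g ->
    exists u s, [/\ divides u 1, primes_seq s & g = u * \prod_(p <- s) p].
  elim: n => // n IH g lt_n g0 gP.
  have [sg|sg] := leqP (size g) 1.
    exists g, [::]; split=> //; last by rewrite big_nil mulr1.
    exact: no_const_prime_size1.
  have [[a [b [gE [sa sb]]]]|N] :=
    pselect (exists a b, g = a * b /\ (size a != 1%N /\ size b != 1%N)).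
    have a0 : a != 0 by apply: contraNneq g0 => a0; rewrite gE a0 mul0r.
    have b0 : b != 0 by apply: contraNneq g0 => b0; rewrite gE b0 mulr0.
    have := lt_n; rewrite gE size_mul // => lt_ab.
    have sa2 : (1 < size a)%N by rewrite ltn_neqAle eq_sym sa size_poly_gt0.
    have sb2 : (1 < size b)%N by rewrite ltn_neqAle eq_sym sb size_poly_gt0.
    have [||u [s [u1 sP aE]]] := IH a _ a0.
    - lia.
    - by apply: (@no_const_primeMl a b); rewrite -gE.
    have [||v [t [v1 tP bE]]] := IH b _ b0.
    - lia.
    - by apply: (@no_const_primeMr a b); rewrite -gE.
    exists (u * v), (s ++ t); split.
    - by case: u1 v1 => x xE [y yE]; exists (x * y); rewrite mulrACA -xE -yE mulr1.
    - by move=> p; rewrite mem_cat => /orP[/sP|/tP].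
    - by rewrite {1}aE {1}bE big_cat /=; ring.
  exists 1, [:: g]; split; [exact: dividesxx| |by rewrite big_seq1 mul1r].
  move=> p; rewrite inE => /eqP ->; apply: irreducible_prime => // a b gE.
  case: (eqVneq (size a) 1%N) => [|sa]; first by left.
  case: (eqVneq (size b) 1%N) => [|sb]; first by right.
  by case: N; exists a, b.
move=> f f0; have [c [g [c0 fE gP]]] := content_split f0.
have g0 : g != 0 by apply: contraNneq f0 => g0; rewrite fE g0 mulr0.
have [u [s [u1 sP gE]]] := prim _ _ (leqnn _) g0 gP.
have [v [t [[w v1] tP cE]]] := U c0.
exists (v%:P * u), ([seq p%:P | p <- t] ++ s); split.
- by case: u1 => x xE; exists (w%:P * x); rewrite mulrACA -polyCM -v1 -xE mulr1.
- by move=> p; rewrite mem_cat => /orP[/mapP[q /tP qp ->]|/sP//]; apply: prime_polyC.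
- by rewrite fE {1}cE {1}gE big_cat big_map /= polyCM rmorph_prod /=; ring.
Qed.
End PolyPrimes.

Lemma ufd_field (k : fieldType) : ufd k.
Proof.
move=> a a0; exists a, [::]; split=> //; last by rewrite big_nil mulr1.
by exists a^-1; rewrite mulVf.
Qed.

Lemma divides_morph (A B : comNzRingType) (f : {rmorphism A -> B}) a b :
  divides a b -> divides (f a) (f b).
Proof. by case=> c ->; exists (f c); rewrite rmorphM. Qed.

Lemma ufd_iso (A B : idomainType) (f : {rmorphism A -> B})
    (g : {rmorphism B -> A}) : cancel f g -> cancel g f -> ufd B -> ufd A.
Proof.
move=> fK gK UB a a0.
have [u [s [u1 sP faE]]] : exists u s,
    [/\ divides u 1, primes_seq s & f a = u * \prod_(p <- s) p].
  by apply: UB; rewrite -(rmorph0 f) (can_eq fK).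
exists (g u), [seq g p | p <- s]; split.
- by rewrite -(rmorph1 g); apply: divides_morph.
- move=> _ /mapP[p /sP[p0 pN1 pP] ->]; split.
  + by rewrite -(rmorph0 g) (can_eq gK).
  + by move=> /(divides_morph f); rewrite gK rmorph1.
  + move=> x y /(divides_morph f); rewrite gK rmorphM => /pP[] /(divides_morph g).
      by rewrite fK; left.
    by rewrite fK; right.
- by rewrite -[LHS]fK faE rmorphM rmorph_prod big_map.
Qed.

(** * Multivariate polynomials as univariate ones in the last variable *)

Section MuniBij.
Variables (k : comNzRingType) (n : nat).

Definition muni_inv : {poly {mpoly k[n]}} -> {mpoly k[n.+1]} :=
  horner_eval 'X_ord_max \o map_poly (@mwiden n k).

HB.instance Definition _ := GRing.RMorphism.on muni_inv.

Lemma muni_invC c : muni_inv c%:P = mwiden c.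
Proof. by rewrite /muni_inv /= map_polyC /= /horner_eval hornerC. Qed.

Lemma muni_invX : muni_inv 'X = 'X_ord_max.
Proof. by rewrite /muni_inv /= map_polyX /horner_eval hornerX. Qed.

Lemma mnmwiden_decomp (m : 'X_{1..n.+1}) :
  (mnmwiden [multinom m (widen_ord (leqnSn n) i) | i < n]
    + U_(ord_max) *+ m ord_max)%MM = m.
Proof.
apply/mnmP => i; rewrite mnmDE mulmnE.
have [->|ne] := eqVneq i ord_max; first by rewrite mnmwiden_ordmax mnm1E eqxx mul1n.
rewrite mnm1E eq_sym (negPf ne) mul0n addn0; have lt_i : (i < n)%N.
  by rewrite ltn_neqAle -ltnS ltn_ord andbT; apply: contraNneq ne => e; apply/eqP/val_inj.
have -> : i = widen_ord (leqnSn n) (Ordinal lt_i) by apply: val_inj.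
by rewrite mnmwiden_widen mnmE.
Qed.

Lemma muniK : cancel (@muni n k) muni_inv.
Proof.
move=> p; rewrite muniE rmorph_sum /= [RHS]mpolyE; apply: eq_bigr => m _.
rewrite -mul_polyC rmorphM rmorphXn /= muni_invC muni_invX mwidenZ mwidenX.
by rewrite -scalerAl mpolyXn -mpolyXD mnmwiden_decomp.
Qed.

Lemma muni_mwiden c : muni (mwiden c) = c%:P :> {poly {mpoly k[n]}}.
Proof.
rewrite [RHS](congr1 polyC (mpolyE c)) [LHS](congr1 (fun c => muni (mwiden c)) (mpolyE c)).
rewrite (raddf_sum (@mwiden n k)) (raddf_sum (@muni n k)) (raddf_sum polyC); apply: eq_bigr => m _.
rewrite /= mwidenZ muniZ mwidenX muniE msuppX big_seq1 mcoeffX eqxx scale1r.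
rewrite mnmwiden_ordmax expr0 alg_polyC -mul_polyC -polyCM; congr _%:P.
rewrite mul_mpolyC; congr (_ *: 'X_[_]).
by apply/mnmP => i; rewrite mnmE mnmwiden_widen.
Qed.

Lemma muni_Xmax : muni 'X_ord_max = 'X :> {poly {mpoly k[n]}}.
Proof.
rewrite muniE msuppX big_seq1 mcoeffX eqxx scale1r mnm1E eqxx expr1.
rewrite (_ : [multinom _ | i < n] = 0%MM) ?mpolyX0 ?scale1r //.
apply/mnmP => i; rewrite mnmE mnm1E mnm0E.
by case: eqP => // /(congr1 val) /= e; have := ltn_ord i; rewrite -e ltnn.
Qed.

Lemma muni_invK : cancel muni_inv (@muni n k).
Proof.
apply: poly_ind => [|p c IH]; first by rewrite !rmorph0.
by rewrite !rmorphD !rmorphM /= IH muni_invC muni_invX muni_mwiden muni_Xmax.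
Qed.
End MuniBij.

Lemma ufd_mpoly (k : fieldType) (n : nat) : ufd {mpoly k[n]}.
Proof.
elim: n => [|n IH].
  apply: (@ufd_iso {mpoly k[0]} k (mcoeff 0%MM) (@mpolyC 0 k)); last exact: ufd_field.
    by move=> p; rewrite /= -nvar0_mpolyC.
  by move=> c; rewrite /= mcoeffC eqxx mulr1.
exact: ufd_iso (@muniK k n) (@muni_invK k n) (ufd_poly IH).
Qed.

(** * Noetherian rings *)

Definition is_ideal (A : comNzRingType) (I : A -> Prop) : Prop :=
  [/\ I 0, forall x y, I x -> I y -> I (x + y) & forall a x, I x -> I (a * x)].

Definition noetherian (A : comNzRingType) : Prop :=
  forall I : nat -> A -> Prop, (forall n, is_ideal (I n)) ->
  (forall n x, I n x -> I n.+1 x) -> exists N, forall n x, I n x -> I N x.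

Lemma chain_le (T : Type) (I : nat -> T -> Prop) :
  (forall n x, I n x -> I n.+1 x) ->
  forall m n x, (m <= n)%N -> I m x -> I n x.
Proof.
move=> Imono m n x /subnK <-; elim: (n - m)%N => // d IH /IH.
by rewrite addSn; apply: Imono.
Qed.

(** Were no member maximal, repeated choice of a strictly larger one would give a chain that never
    stabilizes. *)
Lemma noetherian_max (A : comNzRingType) (P : (A -> Prop) -> Prop) I0 :
  noetherian A -> (forall I, P I -> is_ideal I) -> P I0 ->
  exists I, P I /\ forall J, P J -> (forall x, I x -> J x) -> forall x, J x -> I x.
Proof.
move=> Noe Pid P0; apply: contrapT => N.
have step (I : {I | P I}) : exists J : {J | P J},
    (forall x, sval I x -> sval J x) /\ exists x, sval J x /\ ~ sval I x.
  case: I => I PI /=; apply: contrapT => N'; apply: N; exists I; split=> // J PJ IJ x Jx.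
  apply: contrapT => Ix; apply: N'; exists (exist _ J PJ) => /=.
  by split=> //; exists x.
have [f fP] := choice step.
pose c n := iter n f (exist _ I0 P0).
have [||M MP] := Noe (fun n => sval (c n)).
- by move=> n; apply: Pid; apply: svalP.
- by move=> n; have [] := fP (c n).
by have [_ [x [/(MP M.+1) /= x1 x2]]] := fP (c M).
Qed.

Lemma noetherian_field (k : fieldType) : noetherian k.
Proof.
move=> I Iid Imono.
have [[n [x [x0 nx]]]|N] := pselect (exists n x, x != 0 /\ I n x).
  exists n => m y _; have [_ _ IM] := Iid n.
  by rewrite -[y](mulfVK x0); apply: IM.
exists 0%N => n x nx; have [->|x0] := eqVneq x 0; first by case: (Iid 0%N).
by case: N; exists n, x.
Qed.

Lemma noetherian_surj (A B : comNzRingType) (f : {rmorphism A -> B}) :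
  (forall b, exists a, f a = b) -> noetherian A -> noetherian B.
Proof.
move=> fS NA I Iid Imono; have [||N NP] := NA (fun n a => I n (f a)).
- move=> n; have [I0 ID IM] := Iid n; split=> [|x y|a x]; first by rewrite rmorph0.
    by rewrite rmorphD; apply: ID.
  by rewrite rmorphM; apply: IM.
- by move=> n x; apply: Imono.
by exists N => n b; have [a <-] := fS b; apply: NP.
Qed.

(** Hilbert's basis theorem, through the ideals [L d n] of degree [d] coefficients of the elements
    of [I n] of degree at most [d]. *)
Lemma noetherian_poly (A : comNzRingType) : noetherian A -> noetherian {poly A}.
Proof.
move=> NA I Iid Imono.
have Ile := chain_le Imono.
pose L (d n : nat) (c : A) := exists p : {poly A}, [/\ I n p, (size p <= d.+1)%N & p`_d = c].
have Lid d n : is_ideal (L d n).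
  have [I0 ID IM] := Iid n; split.
  - by exists 0; rewrite size_poly0 coef0.
  - move=> x y [p [Ip sp <-]] [q [Iq sq <-]]; exists (p + q); rewrite coefD; split=> //.
      exact: ID.
    by apply: leq_trans (size_polyD _ _) _; rewrite geq_max sp.
  - move=> a x [p [Ip sp <-]]; exists (a%:P * p); rewrite coefCM; split=> //; first exact: IM.
    by rewrite mul_polyC (leq_trans (size_scale_leq _ _)).
have Lmono d n x : L d n x -> L d n.+1 x.
  by case=> p [Ip sp e]; exists p; split=> //; apply: Imono.
have LmonoS d n x : L d n x -> L d.+1 n x.
  case=> p [Ip sp e]; exists ('X * p); split; first by case: (Iid n) => _ _; apply.
    by apply: leq_trans (size_polyMleq _ _) _; rewrite size_polyX.
  by rewrite coefXM /= e.
have Lle d n d' n' x : (d <= d')%N -> (n <= n')%N -> L d n x -> L d' n' x.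
  move=> le_d le_n /(@chain_le _ _ (Lmono d) _ _ _ le_n).
  exact: (@chain_le _ (fun d => L d n') (fun d => @LmonoS d n')).
(* The diagonal chain settles all degrees from [N] on; the finitely many smaller ones get their own
   bounds [M d]. *)
have [N NP] : exists N, forall k x, L k k x -> L N N x.
  by apply: NA => [k|k x]; [apply: Lid | move/Lmono/LmonoS].
have /choice[M MP] : forall d, exists M, forall n x, L d n x -> L d M x.
  by move=> d; apply: NA => [n|n x]; [apply: Lid | apply: Lmono].
exists (maxn N (\max_(d < N) M d)) => n p.
set K := maxn _ _; have [s] := ubnP (size p); elim: s n p => // s IH n p lt_s Ip.
have [->|p0] := eqVneq p 0; first by case: (Iid K).
have sp : (size p).-1.+1 = size p by rewrite prednK // size_poly_gt0.
have : L (size p).-1 K (lead_coef p).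
  have Lp : L (size p).-1 n (lead_coef p) by exists p; rewrite sp.
  have [le|lt] := leqP N (size p).-1.
    have /NP : L (maxn (size p).-1 n) (maxn (size p).-1 n) (lead_coef p).
      by apply: Lle Lp; rewrite ?leq_maxl ?leq_maxr.
    by apply: Lle; rewrite // leq_maxl.
  apply: Lle (MP _ _ _ Lp) => //; rewrite leq_max; apply/orP; right.
  by rewrite (bigD1 (Ordinal lt)) //= leq_maxl.
(* [q] lies in [I K] and has the leading term of [p], so passing to [p - q] lowers the size. *)
case=> q [Iq sq qE].
have [_ ID IM] := Iid (maxn n K).
have Ipq : I (maxn n K) (p - q).
  apply: ID; first by apply: Ile Ip; rewrite leq_maxl.
  by rewrite -mulN1r; apply: IM; apply: Ile Iq; rewrite leq_maxr.
have [_ IDK _] := Iid K; rewrite -[p](subrK q); apply: (IDK) => //.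
apply: IH Ipq; apply: leq_trans (lt_s : (size p <= s)%N).
rewrite -sp ltnS; apply/leq_sizeP => j; rewrite leq_eqVlt => /predU1P[<-|lt].
  by rewrite coefB qE subrr.
rewrite coefB !nth_default ?subrr //; first exact: leq_trans sq lt.
by rewrite -sp.
Qed.

Lemma noetherian_mpoly (k : fieldType) (n : nat) : noetherian {mpoly k[n]}.
Proof.
elim: n => [|n IH].
  apply: (@noetherian_surj k _ (@mpolyC 0 k)); last exact: noetherian_field.
  by move=> p; exists p@_0%MM; rewrite /= -nvar0_mpolyC.
apply: (@noetherian_surj {poly {mpoly k[n]}} _ (@muni_inv k n)).
  by move=> p; exists (muni p); apply: muniK.
exact: noetherian_poly.
Qed.

(** * Regular sequences of leading forms *)

Section Ideals.
Variable A : comNzRingType.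
Implicit Types (I : A -> Prop) (f x y : A).

Lemma is_idealB I x y : is_ideal I -> I x -> I y -> I (x - y).
Proof. by move=> [_ ID IM] Ix Iy; apply: ID => //; rewrite -mulN1r; apply: IM. Qed.

Definition regular_mod I f : Prop := forall x, I (x * f) -> I x.

Definition adjoin I f : A -> Prop := fun h => exists y s, I y /\ h = y + s * f.

Lemma is_ideal_adjoin I f : is_ideal I -> is_ideal (adjoin I f).
Proof.
move=> [I0 ID IM]; split; first by exists 0, 0; rewrite mul0r addr0.
  move=> _ _ [y [s [Iy ->]]] [z [t [Iz ->]]]; exists (y + z), (s + t).
  by split; [apply: ID | ring].
move=> a _ [y [s [Iy ->]]]; exists (a * y), (a * s).
by split; [apply: IM | ring].
Qed.

Lemma adjoin_sub I f y : I y -> adjoin I f y.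
Proof. by move=> Iy; exists y, 0; rewrite mul0r addr0. Qed.
End Ideals.

(** * Leading forms with respect to a weight *)

Section Graded.
Variables (k : fieldType) (d : nat) (mf : measure d).
Local Notation S := {mpoly k[d]}.
Local Notation pi := (@pihomog d k mf).
Implicit Types (p q x y f g h : S) (I G : S -> Prop).

(** The bound is strict, so that [below 0] forces zero and inductions on the weight can start
    there. *)
Definition below (e : nat) p : Prop := {in msupp p, forall m, (mf m < e)%N}.

Lemma below_leq e e' p : (e <= e')%N -> below e p -> below e' p.
Proof. by move=> le pP m /pP lt; apply: leq_trans lt le. Qed.

Lemma below0 e : below e 0.
Proof. by move=> m; rewrite msupp0. Qed.

Lemma below_eq0 p : below 0 p -> p = 0.
Proof. by move=> pP; apply: msuppnil0; case E: (msupp p) => [|m s] //; have := pP m; rewrite E mem_head => /(_ isT). Qed.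

Lemma belowD e p q : below e p -> below e q -> below e (p + q).
Proof.
by move=> pP qP m /msuppD_le; rewrite mem_cat => /orP[/pP|/qP].
Qed.

Lemma belowN e p : below e p -> below e (- p).
Proof. by move=> pP m; rewrite (perm_mem (msuppN p)) => /pP. Qed.

Lemma belowB e p q : below e p -> below e q -> below e (p - q).
Proof. by move=> pP qP; apply: belowD => //; apply: belowN. Qed.

Lemma belowM a b p q : below a.+1 p -> below b q -> below (a + b) (p * q).
Proof.
move=> pP qP m /msuppM_le /allpairsP[[m1 m2] /= [/pP lt1 /qP lt2 ->]].
by rewrite mfD; lia.
Qed.

Lemma belowMS a b p q : below a.+1 p -> below b.+1 q -> below (a + b).+1 (p * q).
Proof. by move=> pP qP; rewrite -addnS; apply: belowM. Qed.

Lemma below_homog e p : p \is e.-homog for mf -> below e.+1 p.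
Proof. by move=> /dhomogP pP m /pP ->. Qed.

Lemma below_pi e p : below e.+1 (pi e p).
Proof. by apply: below_homog; apply: pihomogP. Qed.

Lemma mcoeff_pi e p m : (pi e p)@_m = if mf m == e then p@_m else 0.
Proof.
rewrite pihomogE raddf_sum /=.
rewrite (eq_bigr (fun m' => if m' == m then p@_m else 0)); last first.
  move=> m' _; rewrite mcoeffZ mcoeffX; case: eqP => [->|]; first by rewrite mulr1.
  by rewrite mulr0.
rewrite -big_mkcondr /=; case: (boolP (m \in msupp p)) => mp; last first.
  rewrite big_seq_cond big1 => [|m' /andP[m'p /andP[_ /eqP e']]]; last by rewrite -e' m'p in mp.
  by rewrite (memN_msupp_eq0 mp) if_same.
rewrite (eq_bigl (fun m' => (m' == m) && (mf m == e))); last first.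
  by move=> m'; rewrite andbC; case: eqP => // ->.
case: eqP => [em|ne]; last by rewrite big_pred0 // => m'; rewrite andbF.
rewrite (eq_bigl (pred1 m)); last by move=> m'; rewrite andbT.
by rewrite -big_filter filter_pred1_uniq // big_seq1.
Qed.

Lemma below_sub_pi e p : below e.+1 p -> below e (p - pi e p).
Proof.
move=> pP m; rewrite mcoeff_msupp mcoeffB mcoeff_pi.
case: (mf m =P e) => [_|ne]; first by rewrite subrr eqxx.
rewrite subr0 -mcoeff_msupp => /pP; rewrite ltnS leq_eqVlt => /predU1P[] //.
Qed.

Lemma pi_below e p : below e p -> pi e p = 0.
Proof.
move=> pP; apply/mpolyP => m; rewrite mcoeff_pi mcoeff0; case: eqP => // em.
by apply: memN_msupp_eq0; apply/negP => /pP; rewrite em ltnn.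
Qed.

Lemma below_exists p : exists e, below e p.
Proof. by exists (mmeasure mf p) => m; apply: mmeasure_mnm_lt. Qed.

Lemma piM a b p q : below a.+1 p -> below b.+1 q -> pi (a + b) (p * q) = pi a p * pi b q.
Proof.
move=> pP qP; rewrite -[LHS]subr0.
rewrite -[RHS](@pihomog_dE d k mf (a + b)); last by apply: dhomogM; apply: pihomogP.
apply/eqP; rewrite subr0 -subr_eq0 -raddfB /=; apply/eqP/pi_below.
have -> : p * q - pi a p * pi b q = q * (p - pi a p) + pi a p * (q - pi b q) by ring.
apply: belowD; last by apply: belowM; [apply: below_pi | apply: below_sub_pi].
by rewrite addnC; apply: belowM => //; apply: below_sub_pi.
Qed.

Lemma pi_mul_homog e n s g : g \is e.-homog for mf ->
  pi n (s * g) = (if (e <= n)%N then pi (n - e) s else 0) * g.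
Proof.
move=> gP; rewrite {1}(@pihomog_partitionE d k mf (mmeasure mf s) s) // mulr_suml raddf_sum /=.
have piE i : pi n (pi i s * g) = if (i + e)%N == n then pi i s * g else 0.
  have hP : pi i s * g \is (i + e).-homog for mf by apply: dhomogM gP; apply: pihomogP.
  case: eqP => [<-|/eqP ne]; first by rewrite pihomog_dE.
  exact: pihomog_ne0 hP.
under eq_bigr do rewrite piE.
case: leqP => le_en; last first.
  by rewrite mul0r big1 // => i _; case: eqP => // E; move: le_en; rewrite -E; lia.
have [lt|ge] := ltnP (n - e) (mmeasure mf s).
  rewrite (bigD1 (Ordinal lt)) //= subnK // eqxx big1 ?addr0 // => i ne.
  case: eqP => // E; case/eqP: ne; apply: val_inj => /=; lia.
rewrite pi_below => [|m mP]; last exact: leq_trans (mmeasure_mnm_lt mf mP) ge.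
rewrite mul0r big1 // => i _; case: eqP => // E.
by have := ltn_ord i; lia.
Qed.

(* [G] is the ideal of leading forms of [I]. *)
Record initial_pair I G : Prop := InitialPair {
  ip_ideal : is_ideal I;
  ip_ideal_top : is_ideal G;
  ip_homog : forall e x, G x -> G (pi e x);
  ip_top : forall e h, I h -> below e.+1 h -> G (pi e h);
  ip_lift : forall e g, G g -> pi e g = g ->
    exists h, [/\ I h, below e.+1 h & pi e h = g] }.

Lemma initial_pair0 : initial_pair (eq^~ 0) (eq^~ 0).
Proof.
have id0 : is_ideal (eq^~ (0 : S)).
  by split=> // [x y -> ->|a x ->]; rewrite ?addr0 ?mulr0.
split=> //.
- by move=> e x ->; rewrite raddf0.
- by move=> e h -> _; rewrite raddf0.
- by move=> e g -> _; exists 0; rewrite raddf0; split=> //; apply: below0.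
Qed.

Section Step.
Variables (I G : S -> Prop) (e : nat) (f g : S).
Hypotheses (IG : initial_pair I G) (fP : below e.+1 f) (fg : pi e f = g).
Hypothesis gP : regular_mod G g.

Let gH : g \is e.-homog for mf. Proof. by rewrite -fg; apply: pihomogP. Qed.

(** If [x * f] is in [I], regularity of [g] puts the leading form of [x] in [G], so it is also that
    of some [y] in [I]; passing to [x - y] lowers the weight. *)
Lemma initial_regular : regular_mod I f.
Proof.
move=> x Ixf; have [n xP] := below_exists x.
elim: n x xP Ixf => [|n IH] x xP Ixf.
  by rewrite (below_eq0 xP); case: (ip_ideal IG).
have /gP Gx : G (pi n x * g).
  by rewrite -fg -piM //; apply: (ip_top IG) => //; apply: belowMS.
have [|y [Iy yP yE]] := ip_lift IG Gx (e := n); first by rewrite pihomog_id.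
have [_ ID IM] := ip_ideal IG.
rewrite -[x](subrK y); apply: ID => //; apply: IH.
  have -> : x - y = (x - y) - pi n (x - y) by rewrite raddfB /= yE subrr subr0.
  by apply: below_sub_pi; apply: belowB.
by rewrite mulrBl; apply: is_idealB (ip_ideal IG) _ _ => //; rewrite mulrC; apply: IM.
Qed.

(** The leading form of [y + s * f] is visibly in [G + (g)] unless the top parts of [y] and [s * f]
    cancel. In that case regularity puts the top part of [s] in [G]; it lifts to some [z] in [I],
    and [z * f] is moved from [s * f] to [y]. *)
Lemma initial_adjoin_top n h :
  adjoin I f h -> below n.+1 h -> adjoin G g (pi n h).
Proof.
move=> [y [s [Iy hE]]] hP; have [m sP] := below_exists s.
have [_ ID IM] := ip_ideal IG.
elim: m s sP y Iy hE => [|m IH] s sP y Iy hE.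
  have s0 := below_eq0 sP; rewrite s0 mul0r addr0 in hE.
  by apply: adjoin_sub; apply: (ip_top IG) => //; rewrite hE.
have sfP : below (m + e).+1 (s * f) by apply: belowMS.
have [le|lt] := leqP (m + e) n.
  have sfP' : below n.+1 (s * f) by apply: below_leq sfP.
  exists (pi n y), (if (m + e)%N == n then pi m s else 0).
  split; last first.
    rewrite hE raddfD /=; congr (_ + _).
    case: eqP => [<-|/eqP ne]; first by rewrite piM // fg.
    rewrite mul0r pi_below //; apply: below_leq sfP.
    by rewrite ltn_neqAle ne.
  apply: (ip_top IG) => //; have -> : y = h - s * f by rewrite hE addrK.
  exact: belowB.
have yP : below (m + e).+1 y.
  have -> : y = h - s * f by rewrite hE addrK.
  by apply: belowB => //; apply: below_leq hP; apply: leqW.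
have Gs : G (pi m s).
  apply: gP; have -> : pi m s * g = - pi (m + e) y.
    apply/eqP; rewrite -addr_eq0 addrC -fg -piM // -raddfD /= -hE pi_below //.
    exact: below_leq hP.
  rewrite -mulN1r; have [_ _] := ip_ideal_top IG; apply.
  exact: (ip_top IG).
have [|z [Iz zP zE]] := ip_lift IG Gs (e := m); first by rewrite pihomog_id.
apply: (IH (s - z) _ (y + z * f)).
- have -> : s - z = (s - z) - pi m (s - z) by rewrite raddfB /= zE subrr subr0.
  by apply: below_sub_pi; apply: belowB.
- by apply: ID => //; rewrite mulrC; apply: IM.
- by rewrite hE; ring.
Qed.

(** Iterating this lifts a regular sequence of leading forms to a regular sequence, with the ideal
    of leading forms known at each stage. *)
Lemma initial_pair_adjoin : initial_pair (adjoin I f) (adjoin G g).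
Proof.
split.
- exact: is_ideal_adjoin (ip_ideal IG).
- exact: is_ideal_adjoin (ip_ideal_top IG).
- move=> n _ [y [s [Gy ->]]]; rewrite raddfD /= (pi_mul_homog _ _ gH).
  by exists (pi n y), (if (e <= n)%N then pi (n - e) s else 0); split=> //; apply: (ip_homog IG).
- exact: initial_adjoin_top.
- move=> n _ [y [s [Gy ->]]]; rewrite raddfD /= (pi_mul_homog _ _ gH) => <-.
  have [|h [Ih hP hE]] := ip_lift IG (ip_homog IG n Gy) (e := n).
    by rewrite pihomog_id.
  set t := if _ then _ else _.
  exists (h + t * f); split; first by exists h, t.
    apply: belowD => //; rewrite /t; case: leqP => le; last by rewrite mul0r; apply: below0.
    by rewrite -{1}(subnK le); apply: belowMS => //; apply: below_pi.
  rewrite raddfD /= hE; congr (_ + _); rewrite /t.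
  case: leqP => le; last by rewrite !mul0r raddf0.
  by rewrite -{1}(subnK le) piM ?fg ?pihomog_id //; apply: below_pi.
Qed.
End Step.
End Graded.

(** * Monomial ideals and elements regular modulo them *)

Section MonomialIdeals.
Variables (k : fieldType) (d : nat).
Local Notation S := {mpoly k[d]}.
Implicit Types (m mu nu : 'X_{1..d}) (ms : seq 'X_{1..d}) (p x : S).

Definition mon_ideal ms p : Prop :=
  {in msupp p, forall m, has (fun mu => (mu <= m)%MM) ms}.

Definition mnm_disjoint m mu : Prop := forall i, m i = 0%N \/ mu i = 0%N.

Lemma mnm_disjoint_le m mu nu : mnm_disjoint mu nu ->
  (nu <= m + mu)%MM -> (nu <= m)%MM.
Proof.
move=> D /mnm_lepP H; apply/mnm_lepP => i; have := H i; rewrite mnmDE.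
by case: (D i) => ->; rewrite ?addn0.
Qed.

Lemma mcoeffMX_eq0 x mu m : ~~ (mu <= m)%MM -> (x * 'X_[mu])@_m = 0.
Proof.
move=> N; apply: memN_msupp_eq0; apply: contra N => /msuppM_le.
case/allpairsP => -[m1 m2] /= [_]; rewrite msuppX inE => /eqP -> ->.
by apply/mnm_lepP => i; rewrite mnmDE leq_addl.
Qed.

Lemma mon_ideal_nil : mon_ideal [::] = eq^~ 0.
Proof.
apply/funext => p; apply/propext; split=> [H|->] //; last by move=> m; rewrite msupp0.
by apply: msuppnil0; case E: (msupp p) => [|m s] //; have := H m; rewrite E mem_head => /(_ isT).
Qed.

Lemma mon_ideal_cons mu ms : mon_ideal (mu :: ms) = adjoin (mon_ideal ms) 'X_[mu].
Proof.
apply/funext => p; apply/propext; split=> [H|[y [s [yP ->]]] m].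
  pose s : S := \sum_(m <- msupp p | (mu <= m)%MM) p@_m *: 'X_[m - mu].
  have sE : s * 'X_[mu] = \sum_(m <- msupp p | (mu <= m)%MM) p@_m *: 'X_[m].
    rewrite mulr_suml; apply: eq_bigr => m le.
    by rewrite -scalerAl -mpolyXD submK.
  exists (p - s * 'X_[mu]), s; rewrite subrK; split=> // m.
  have -> : p - s * 'X_[mu] = \sum_(m <- msupp p | ~~ (mu <= m)%MM) p@_m *: 'X_[m].
    by rewrite {1}[p]mpolyE sE (bigID (fun m => (mu <= m)%MM)) /= addrAC subrr add0r.
  move=> /msupp_sum_le /flattenP[l /mapP[m']]; rewrite mem_filter => /andP[N m'p] ->.
  move=> /msuppZ_le; rewrite msuppX inE => /eqP ->.
  by have := H _ m'p; rewrite /= (negPf N).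
move=> /msuppD_le; rewrite mem_cat => /orP[/yP /= ->|]; first by rewrite orbT.
move=> /msuppM_le /allpairsP[[m1 m2] /= [_]]; rewrite msuppX inE => /eqP -> ->.
by apply/orP; left; apply/mnm_lepP => i; rewrite mnmDE leq_addl.
Qed.

Lemma mon_ideal_regular ms mu : {in ms, forall nu, mnm_disjoint mu nu} ->
  regular_mod (mon_ideal ms) ('X_[mu] : S).
Proof.
move=> D x H m mx; have /hasP[nu nus le] : has (fun nu => (nu <= m + mu)%MM) ms.
  by apply: H; rewrite mcoeff_msupp addmC mcoeffMX -mcoeff_msupp.
by apply/hasP; exists nu => //; apply: mnm_disjoint_le le; apply: D.
Qed.

(** A monomial [m] of [x] outside [(m1)] misses some variable [z i]. Every [nu j] other than [nu i]
    contains [z i], so nothing cancels the monomial [m + nu i] of the product. It is therefore a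
    multiple of a generator, which is not [m1] and is disjoint from [nu i], hence divides [m]. *)
Lemma mon_ideal_regular_sum (I : finType) (nu : I -> 'X_{1..d}) (z : I -> 'I_d) m1 ms :
  (forall m, ~~ (m1 <= m)%MM -> exists i, m (z i) = 0%N) ->
  (forall i, (0 < m1 (z i))%N) ->
  (forall i, nu i (z i) = 0%N) -> (forall i j, j != i -> (0 < nu j (z i))%N) ->
  (forall i, {in ms, forall mu, mnm_disjoint (nu i) mu}) ->
  regular_mod (mon_ideal (m1 :: ms)) (\sum_i 'X_[nu i] : S).
Proof.
move=> m1N m1z nuz nuz' nuD x H m mx.
have [le|/m1N[i mz]] := boolP (m1 <= m)%MM; first by rewrite /= le.
have : has (fun mu => (mu <= m + nu i)%MM) (m1 :: ms).
  apply: H; rewrite mcoeff_msupp mulr_sumr raddf_sum (bigD1 i) //= addmC mcoeffMX.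
  rewrite big1 ?addr0 -?mcoeff_msupp // => j ji; apply: mcoeffMX_eq0.
  apply/negP => /mnm_lepP/(_ (z i)); rewrite mnmDE mz nuz.
  by have := nuz' _ _ ji; lia.
rewrite /=; case/orP => [/mnm_lepP/(_ (z i))|/hasP[mu mus le]].
  by rewrite mnmDE mz nuz; have := m1z i; lia.
apply/orP; right; apply/hasP; exists mu => //.
by apply: mnm_disjoint_le le; apply: nuD.
Qed.
End MonomialIdeals.

(** * A weight preferring entries near the diagonal *)

Section Weight.
Variables (n : nat).
Local Notation idx := (@mxvec_index n n).

(* This is [2 n^2 - (i - j)^2]. *)
Definition wt (i j : nat) : nat := 2 * (i * j) + (n ^ 2 - i ^ 2) + (n ^ 2 - j ^ 2).

Definition mxweight (m : 'X_{1..n * n}) : nat :=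
  \sum_(i < n) \sum_(j < n) m (idx i j) * wt i j.

Fact mxweight0 : mxweight 0%MM = 0%N.
Proof. by rewrite /mxweight big1 // => i _; rewrite big1 // => j _; rewrite mnm0E. Qed.

Fact mxweightD : {morph mxweight : m1 m2 / (m1 + m2)%MM >-> (m1 + m2)%N}.
Proof.
move=> m1 m2; rewrite /mxweight -big_split; apply: eq_bigr => i _ /=.
by rewrite -big_split; apply: eq_bigr => j _ /=; rewrite mnmDE mulnDl.
Qed.

HB.instance Definition _ := isMeasure.Build (n * n) mxweight mxweight0 mxweightD.

Lemma idx_inj i j i' j' : idx i j = idx i' j' -> i = i' /\ j = j'.
Proof.
have [f fK _] := curry_mxvec_bij n n.
move=> e; have := congr1 f e.
by rewrite (fK (i, j)) ?inE // (fK (i', j')) ?inE // => -[].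
Qed.

Lemma idx_eq i j i' j' : (idx i j == idx i' j') = (i == i') && (j == j').
Proof.
by apply/eqP/andP => [/idx_inj[-> ->]|[/eqP-> /eqP->]].
Qed.

Lemma mxweight_idx i j : mxweight U_(idx i j) = wt i j.
Proof.
rewrite /mxweight (bigD1 i) //= (bigD1 j) //= mnm1E eqxx mul1n !big1 ?addn0 //.
  move=> i' ne; rewrite big1 // => j' _.
  by rewrite mnm1E idx_eq eq_sym (negPf ne).
by move=> j' ne; rewrite mnm1E idx_eq [j == _]eq_sym (negPf ne) andbF.
Qed.

Definition diag_mnm m (r c : 'I_m -> 'I_n) : 'X_{1..n * n} := (\sum_a U_(idx (r a) (c a)))%MM.

Lemma diag_mnmE m (r c : 'I_m -> 'I_n) i j :
  diag_mnm r c (idx i j) = (\sum_a ((r a == i) && (c a == j)))%N.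
Proof. by rewrite /diag_mnm mnm_sumE; apply: eq_bigr => a _; rewrite mnm1E idx_eq. Qed.

Lemma diag_mnm_weight m (r c : 'I_m -> 'I_n) : mxweight (diag_mnm r c) = (\sum_a wt (r a) (c a))%N.
Proof.
rewrite /diag_mnm (big_morph _ mxweightD mxweight0).
by apply: eq_bigr => a _; rewrite mxweight_idx.
Qed.

Lemma wtE (i j : 'I_n) : (wt i j + (i ^ 2 + j ^ 2) = 2 * (i * j) + 2 * n ^ 2)%N.
Proof.
have := ltn_ord i; have := ltn_ord j; rewrite /wt => lj li.
have : (i ^ 2 <= n ^ 2)%N by rewrite leq_exp2r // ltnW.
have : (j ^ 2 <= n ^ 2)%N by rewrite leq_exp2r // ltnW.
lia.
Qed.

(** Sum the inequalities [2 * (u a * u (s a)) <= u a ^ 2 + u (s a) ^ 2]; the one at an index moved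
    by [s] is strict. *)
Lemma rearrangement m (u : 'I_m -> nat) (s : 'S_m) : injective u -> s != 1%g ->
  (\sum_a u a * u (s a) < \sum_a u a * u a)%N.
Proof.
move=> uI s1; have [a sa] : exists a, s a != a.
  apply: contrapT => N; case/eqP: s1; apply/permP => a; rewrite perm1.
  by apply/eqP/negPn/negP => sa; apply: N; exists a.
rewrite -(ltn_pmul2l (isT : 0 < 2)%N) !big_distrr /=.
have -> : (\sum_i 2 * (u i * u i) = \sum_i (u i ^ 2 + u (s i) ^ 2))%N.
  transitivity (\sum_(i < m) u i ^ 2 + \sum_(i < m) u i ^ 2)%N.
    by rewrite -big_split /=; apply: eq_bigr => i _; lia.
  rewrite big_split /=; congr (_ + _)%N.
  exact: reindex_inj (@perm_inj _ s).
rewrite (bigD1 a) //= [X in (_ < X)%N](bigD1 a) //= -addSn leq_add //.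
  have [_ E] := nat_Cauchy (u a) (u (s a)).
  have := nat_Cauchy (u a) (u (s a)) => /leqifP; case: eqP => // /uI e.
  by rewrite -e eqxx in sa.
by apply: leq_sum => i _; case: (nat_Cauchy (u i) (u (s i))).
Qed.

(** Only the cross terms [2 * (r a * c (s a))] of the total weight depend on [s]. Since [r] and [c]
    differ by a constant, the rearrangement inequality applies to them. *)
Lemma diag_mnm_perm_weight m (r c : 'I_m -> 'I_n) (t t' : nat) (s : 'S_m) :
  injective r -> (forall a, r a + t = c a + t')%N -> s != 1%g ->
  (mxweight (diag_mnm r (c \o s)) < mxweight (diag_mnm r c))%N.
Proof.
move=> rI rc s1; rewrite !diag_mnm_weight /=.
pose u a := (r a + t)%N.
have uI : injective u by move=> a b /eqP; rewrite eqn_add2r => /eqP/val_inj/rI.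
have lt := rearrangement uI s1.
pose g x := (x ^ 2 + 2 * (t * x))%N.
(* Here [u (s' a)] also equals [c (s' a) + t']. All sums except those of [wt] and [u a * u (s' a)]
   are unchanged by a permutation. *)
have E s' : (\sum_(a < m) wt (r a) (c (s' a))
    + \sum_(a < m) (r a ^ 2 + 2 * (t' * r a) + 2 * (t * t')) + \sum_(a < m) g (c (s' a))
   = 2 * (\sum_(a < m) u a * u (s' a)) + \sum_(a < m) 2 * n ^ 2)%N.
  rewrite big_distrr /= -!big_split /=; apply: eq_bigr => a _.
  by have := wtE (r a) (c (s' a)); rewrite {2}/u rc /u /g; lia.
have gE : (\sum_(a < m) g (c (s a)) = \sum_(a < m) g (c a))%N.
  by apply/esym; apply: reindex_inj (@perm_inj _ s).
have := E s; have := E id; rewrite gE; move: lt.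
move: (\sum_(a < m) g _)%N (\sum_(a < m) (_ + _ + _))%N (\sum_(a < m) 2 * _)%N.
move: (\sum_(a < m) u a * u (s a))%N (\sum_(a < m) u a * u a)%N.
move: (\sum_(a < m) wt (r a) (c (s a)))%N (\sum_(a < m) wt (r a) (c a))%N => *; lia.
Qed.
End Weight.

(** * The minors of the generic matrix *)

Section Leading.
Variables (k : fieldType) (d : nat) (mf : measure d).
Local Notation S := {mpoly k[d]}.
Implicit Types (f g : S).

Definition leading e f g : Prop := below mf e.+1 f /\ pihomog mf e f = g.

Lemma leading1 : leading 0 1 1.
Proof.
by split; [apply: below_homog; apply: dhomog1 | apply: pihomog_dE; apply: dhomog1].
Qed.

Lemma leadingM e1 f1 g1 e2 f2 g2 :
  leading e1 f1 g1 -> leading e2 f2 g2 -> leading (e1 + e2) (f1 * f2) (g1 * g2).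
Proof. by move=> [b1 <-] [b2 <-]; split; [apply: belowMS | apply: piM]. Qed.

Lemma leadingXn e f g n : leading e f g -> leading (n * e) (f ^+ n) (g ^+ n).
Proof.
move=> L; elim: n => [|n IH]; first by rewrite !expr0; apply: leading1.
by rewrite !exprS mulSn; apply: leadingM.
Qed.

Lemma leading_sum e (I : Type) (r : seq I) (f g : I -> S) :
  (forall i, leading e (f i) (g i)) -> leading e (\sum_(i <- r) f i) (\sum_(i <- r) g i).
Proof.
move=> L; split.
  apply: big_ind => [||i _]; [exact: below0 | exact: belowD | by case: (L i)].
by rewrite raddf_sum /=; apply: eq_bigr => i _; case: (L i).
Qed.
End Leading.

Section RegularSequence.
Variables (k : fieldType) (n' : nat).
Local Notation n := n'.+1.
Local Notation S := {mpoly k[n * n]}.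
Local Notation X := (generic_mx k n).
Local Notation mf := (@mxweight n : measure (n * n)).

Definition minor (i j : 'I_n) : S := \det (row' i (col' j X)).

(** By [diag_mnm_perm_weight], every permutation but the identity contributes a monomial of smaller
    weight. *)
Lemma det_leading m (r c : 'I_m -> 'I_n) (t t' : nat) :
  injective r -> (forall a, r a + t = c a + t')%N ->
  leading mf (mxweight (diag_mnm r c)) (\det (\matrix_(a, b) X (r a) (c b))) 'X_[diag_mnm r c].
Proof.
move=> rI rc; rewrite /determinant (bigD1 1%g) //= odd_perm1 expr0 mul1r.
have prodE (s : 'S_m) :
    \prod_i (\matrix_(a, b) X (r a) (c b)) i (s i) = 'X_[diag_mnm r (c \o s)] :> S.
  rewrite /diag_mnm -mprodXE; apply: eq_bigr => a _; rewrite !mxE //.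
have low : below mf (mxweight (diag_mnm r c))
    (\sum_(s : 'S_m | s != 1%g) (-1) ^+ s * \prod_i (\matrix_(a, b) X (r a) (c b)) i (s i)).
  apply: big_ind => [||s s1]; [exact: below0 | exact: belowD |].
  rewrite prodE -signr_odd; have Xs : below mf (mxweight (diag_mnm r c)) ('X_[k, diag_mnm r (c \o s)]).
    by move=> m0; rewrite msuppX inE => /eqP ->; apply: diag_mnm_perm_weight rc s1.
  by case: (odd _); rewrite ?expr1 ?expr0 ?mulN1r ?mul1r //; apply: belowN.
have -> : \prod_i (\matrix_(a, b) X (r a) (c b)) i ((1%g : 'S_m) i) = 'X_[diag_mnm r c] :> S.
  rewrite prodE; congr 'X_[_]; apply: eq_bigr => a _; by rewrite /= perm1.
have hX : ('X_[diag_mnm r c] : S) \is (mxweight (diag_mnm r c)).-homog for mf by rewrite dhomogX.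
split.
  apply: belowD; first exact: below_homog.
  exact: below_leq low.
by rewrite raddfD /= (pi_below low) addr0 pihomog_dE.
Qed.

Lemma minor_leading (i j : 'I_n) (t t' : nat) :
  (forall a, lift i a + t = lift j a + t')%N ->
  leading mf (mxweight (diag_mnm (lift i) (lift j))) (minor i j) 'X_[diag_mnm (lift i) (lift j)].
Proof.
move=> H; rewrite /minor; have -> : row' i (col' j X) = \matrix_(a, b) X (lift i a) (lift j b).
  by apply/matrixP => a b; rewrite !mxE.
by apply: det_leading H; apply: lift_inj.
Qed.

Variables (a b : nat).
Let w1 := minor ord0 ord_max.
Let w2 := minor ord_max ord0.
Let I1 := adjoin (eq^~ 0) (\det X).
Let I2 := adjoin I1 (w1 ^+ a).
Let I3 := adjoin I2 (w2 ^+ b).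
Let m0 := diag_mnm id (@id 'I_n).
Let m1 := (diag_mnm (lift ord0) (lift (@ord_max n')) *+ a)%MM.
Let m2 := (diag_mnm (lift (@ord_max n')) (lift ord0) *+ b)%MM.

Lemma diag_mnm_supp m (r s : 'I_m -> 'I_n) e i j : 
  (forall x, r x = i -> s x = j -> False) -> (diag_mnm r s *+ e)%MM (mxvec_index i j) = 0%N.
Proof.
move=> H; rewrite mulmnE diag_mnmE big1 // => x _.
by case: eqP => // /H N; case: eqP => // /N.
Qed.

Lemma mnm_disjointP (m m' : 'X_{1..n * n}) :
  (forall i j, m (mxvec_index i j) = 0%N \/ m' (mxvec_index i j) = 0%N) -> mnm_disjoint m m'.
Proof. by move=> H z; case/mxvec_indexP: z. Qed.

Let lift0E x : (lift ord0 x : 'I_n) = x.+1 :> nat. Proof. by rewrite /= /bump. Qed.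
Let liftmaxE x : (lift (@ord_max n') x : 'I_n) = x :> nat.
Proof. by rewrite lift_max. Qed.

(** The monomials [m0], [m1], [m2] live on the main diagonal, the one below it and the one above it,
    so they are pairwise disjoint. *)
Let m1_supp (i j : 'I_n) : i <> j.+1 :> nat -> m1 (mxvec_index i j) = 0%N.
Proof. by move=> ne; apply: diag_mnm_supp => x ei ej; apply: ne; rewrite -ei -ej lift0E liftmaxE. Qed.
Let m2_supp (i j : 'I_n) : j <> i.+1 :> nat -> m2 (mxvec_index i j) = 0%N.
Proof. by move=> ne; apply: diag_mnm_supp => x ei ej; apply: ne; rewrite -ei -ej lift0E liftmaxE. Qed.
Let m0_supp (i j : 'I_n) : i <> j -> m0 (mxvec_index i j) = 0%N.
Proof. by move=> ne; have := @diag_mnm_supp _ id id 1 i j; rewrite mulm1n; apply=> x ei ej; apply: ne; rewrite -ei -ej. Qed.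

Let disj (f g : 'I_n -> 'I_n -> Prop) (m m' : 'X_{1..n * n}) :
  (forall i j, ~ f i j -> m (mxvec_index i j) = 0%N) ->
  (forall i j, ~ g i j -> m' (mxvec_index i j) = 0%N) ->
  (forall i j, f i j -> g i j -> False) -> mnm_disjoint m m'.
Proof.
move=> fP gP fg; apply: mnm_disjointP => i j.
have [fij|/fP ->] := pselect (f i j); last by left.
by right; apply: gP => /(fg _ _ fij).
Qed.

Let ip1 : initial_pair mf I1 (mon_ideal [:: m0]).
Proof.
rewrite mon_ideal_cons mon_ideal_nil.
have [b0 p0] := @det_leading _ id id 0 0 (@inj_id _) (fun=> erefl).
have -> : I1 = adjoin (eq^~ 0) (\det (\matrix_(i, j) X i j)).
  by rewrite /I1; congr (adjoin _ (\det _)); apply/matrixP => i j; rewrite [RHS]mxE.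
apply: initial_pair_adjoin b0 p0 _; first exact: initial_pair0.
by rewrite -mon_ideal_nil; apply: mon_ideal_regular.
Qed.

Let reg1 : regular_mod (mon_ideal [:: m0]) ('X_[m1] : S).
Proof.
apply: mon_ideal_regular => mm; rewrite inE => /eqP ->.
apply: disj m1_supp m0_supp _ => i j e ij; move: e; rewrite ij; lia.
Qed.

Let lead1 : leading mf (a * mxweight (diag_mnm (lift ord0) (lift (@ord_max n')))) (w1 ^+ a) 'X_[m1].
Proof.
rewrite -mpolyXn; apply: leadingXn; apply: (@minor_leading _ _ 0 1) => x.
by rewrite lift0E liftmaxE addn0 addn1.
Qed.

Let ip2 : initial_pair mf I2 (mon_ideal [:: m1; m0]).
Proof.
have [b1 p1] := lead1; rewrite mon_ideal_cons.
exact: initial_pair_adjoin ip1 b1 p1 reg1.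
Qed.

Let reg2 : regular_mod (mon_ideal [:: m1; m0]) ('X_[m2] : S).
Proof.
apply: mon_ideal_regular => mm; rewrite !inE => /orP[] /eqP ->.
  apply: disj m2_supp m1_supp _ => i j /= ; lia.
apply: disj m2_supp m0_supp _ => i j e ij; move: e; rewrite ij; lia.
Qed.

Let lead2 : leading mf (b * mxweight (diag_mnm (lift (@ord_max n')) (lift ord0))) (w2 ^+ b) 'X_[m2].
Proof.
rewrite -mpolyXn; apply: leadingXn; apply: (@minor_leading _ _ 1 0) => x.
by rewrite lift0E liftmaxE addn0 addn1.
Qed.

Let ip3 : initial_pair mf I3 (mon_ideal [:: m2; m1; m0]).
Proof.
have [b1 p1] := lead2; rewrite mon_ideal_cons.
exact: initial_pair_adjoin ip2 b1 p1 reg2.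
Qed.

Lemma minors_regular1 : regular_mod I1 (w1 ^+ a).
Proof. by have [b1 p1] := lead1; apply: initial_regular ip1 b1 p1 reg1. Qed.
Lemma minors_regular2 : regular_mod I2 (w2 ^+ b).
Proof. by have [b1 p1] := lead2; apply: initial_regular ip2 b1 p1 reg2. Qed.

Variable c : nat.
Hypothesis c_gt0 : (0 < c)%N.
Let v := \sum_i minor i i ^+ c.
Let nu (i : 'I_n) := (diag_mnm (lift i) (lift i) *+ c)%MM.

Let nu_supp (l i j : 'I_n) : i <> j -> nu l (mxvec_index i j) = 0%N.
Proof. by move=> ne; apply: diag_mnm_supp => x ei ej; apply: ne; rewrite -ei -ej. Qed.

(** Having one common weight, the leading monomials of the powers of the principal minors add up to
    the leading form of [v]. *)
Let wt_diag : forall i : 'I_n, mxweight (diag_mnm (lift i) (lift i)) = (n' * (2 * n ^ 2))%N.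
Proof.
move=> i; rewrite diag_mnm_weight (eq_bigr (fun=> 2 * n ^ 2)%N).
  by rewrite big_const_ord iter_addn_0 mulnC.
by move=> x _; have := wtE (lift i x) (lift i x); set y := nat_of_ord _; lia.
Qed.

Let lead3 : leading mf (c * (n' * (2 * n ^ 2))) v (\sum_i 'X_[nu i]).
Proof.
apply: leading_sum => i; rewrite -mpolyXn; apply: leadingXn.
by rewrite -(wt_diag i); apply: (@minor_leading _ _ 0 0).
Qed.

(** A monomial that is not a multiple of the full diagonal [m0] misses some diagonal variable, and
    exactly one [nu i] misses that variable too, because [c] is positive. *)
Let reg3 : regular_mod (mon_ideal [:: m2; m1; m0]) (\sum_i 'X_[nu i] : S).
Proof.
have -> : mon_ideal [:: m2; m1; m0] = mon_ideal [:: m0; m2; m1] :> (S -> Prop).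
  apply/funext => p; apply/propext; split=> H m /H /=; rewrite !orbF;
  by case: (m0 <= m)%MM; case: (m1 <= m)%MM; case: (m2 <= m)%MM.
have m0E i : m0 (mxvec_index i i) = 1%N.
  rewrite diag_mnmE (bigD1 i) //= eqxx big1 // => j ne; by rewrite (negPf ne).
apply: (@mon_ideal_regular_sum _ _ _ nu (fun i => mxvec_index i i)).
- move=> m N; apply: contrapT => H; move/negP: N; apply; apply/mnm_lepP => z.
  case/mxvec_indexP: z => i j; have [->|/eqP ne] := eqVneq i j; last by rewrite m0_supp.
  rewrite m0E lt0n; apply/eqP => E; apply: H; by exists j.
- by move=> i; rewrite m0E.
- by move=> i; apply: diag_mnm_supp => x E; have := neq_lift i x; rewrite E eqxx.
- move=> i j ji; rewrite mulmnE diag_mnmE muln_gt0 c_gt0 andbT.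
  have [x ix _] := unlift_some ji.
  by rewrite (bigD1 x) //= -ix eqxx.
- move=> i mm; rewrite !inE => /orP[] /eqP ->.
    apply: disj (@nu_supp i) m2_supp _ => p q -> /= ; lia.
  apply: disj (@nu_supp i) m1_supp _ => p q -> /= ; lia.
Qed.

Lemma minors_regular3 : regular_mod I3 v.
Proof. by have [b1 p1] := lead3; apply: initial_regular ip3 b1 p1 reg3. Qed.
End RegularSequence.

(** * The determinantal ring *)

Definition domain (R : comNzRingType) : Prop :=
  forall x y : R, x * y = 0 -> x = 0 \/ y = 0.

Section Domain.
Variable R : comNzRingType.
Hypothesis dom : domain R.

Lemma domain_mulI (a x y : R) : a <> 0 -> a * x = a * y -> x = y.
Proof.
move=> a0 /eqP; rewrite -subr_eq0 -mulrBr => /eqP/dom[//|/eqP].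
by rewrite subr_eq0 => /eqP.
Qed.

Lemma domain_expr_neq0 (a : R) n : a <> 0 -> a ^+ n <> 0.
Proof.
move=> a0; elim: n => [|n IH]; first by rewrite expr0; apply/eqP/oner_neq0.
by rewrite exprS => /dom[].
Qed.
End Domain.

(* Every fraction p / q has a least denominator in the localization of R at the powers of w,
   as if that localization were factorial. *)
Definition least_denominators (R : comNzRingType) (w : R) : Prop :=
  forall p q : R, q <> 0 -> exists l, [/\ l <> 0, divides q (l * p)
    & forall x, divides q (x * p) -> exists N, divides l (w ^+ N * x)].

(** * Elimination: [R] and the fixed ring of [tau] agree after inverting [w] *)

Section Elimination.
Variables (S : idomainType) (R : comNzRingType).
Variables (pi : {rmorphism S -> R}) (tau : {rmorphism S -> S}) (w : S).
Hypothesis colon : forall a b : S, b != 0 ->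
  exists l, forall x, divides b (x * a) <-> divides l x.
Hypothesis tauK : forall p, tau (tau p) = tau p.
Hypothesis tauw : tau w = w.
Hypothesis pi_surj : forall r, exists p, pi p = r.
Hypothesis pi_inj : forall p, tau p = p -> pi p = 0 -> p = 0.
Hypothesis clear : forall p, exists N p', tau p' = p' /\ pi (w ^+ N * p) = pi p'.

(** Exponents may be enlarged, which lets two elements be cleared by the same power of [w]. *)
Lemma clear_le p : exists N, forall M, (N <= M)%N ->
  exists p', tau p' = p' /\ pi w ^+ M * pi p = pi p'.
Proof.
have [N [p' [p'P E]]] := clear p; exists N => M /subnK <-.
exists (w ^+ (M - N) * p'); split; first by rewrite rmorphM rmorphXn /= tauw p'P.
by rewrite rmorphM /= -E !rmorphM !rmorphXn /= exprD; ring.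
Qed.

Lemma pi_fixed_inj p q : tau p = p -> tau q = q -> pi p = pi q -> p = q.
Proof.
move=> pP qP E; apply/eqP; rewrite -subr_eq0; apply/eqP/pi_inj.
  by rewrite rmorphB pP qP.
by rewrite rmorphB /= E subrr.
Qed.

Lemma elimination_domain :
  (forall N x, pi w ^+ N * x = 0 -> x = 0) -> domain R.
Proof.
move=> wreg x y; have [p <-] := pi_surj x; have [q <-] := pi_surj y => pq0.
have [N [p' [p'P Ep]]] := clear p; have [M [q' [q'P Eq]]] := clear q.
have : p' * q' = 0.
  apply: pi_inj; first by rewrite rmorphM p'P q'P.
  rewrite rmorphM /= -Ep -Eq !rmorphM !rmorphXn /=.
  by transitivity (pi w ^+ N * pi w ^+ M * (pi p * pi q)); [ring | rewrite pq0 mulr0].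
move/eqP; rewrite mulf_eq0 => /orP[]/eqP E0; [left|right].
  by apply: (wreg N); rewrite -rmorphXn -rmorphM Ep E0 rmorph0.
by apply: (wreg M); rewrite -rmorphXn -rmorphM Eq E0 rmorph0.
Qed.

Lemma elimination_least_denominators :
  domain R -> pi w <> 0 -> least_denominators (pi w).
Proof.
move=> dom w0 p q q0; have [P PE] := pi_surj p; have [Q QE] := pi_surj q.
have [N1 H1] := clear_le P; have [N2 H2] := clear_le Q.
have [P' [P'P EP]] := H1 _ (leq_maxl N1 N2).
have [Q' [Q'P EQ]] := H2 _ (leq_maxr N1 N2).
set N := maxn N1 N2 in EP EQ; rewrite PE in EP; rewrite QE in EQ.
have wN0 := domain_expr_neq0 dom (n := N) w0.
have Q'0 : Q' != 0.
  by apply/eqP => E; move: EQ; rewrite E rmorph0 => /dom[].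
have [l lP] := colon P' Q'0.
(* [l] generates a colon ideal in [S]. Its image under [tau] does so in the fixed ring, since [tau]
   preserves divisibility and fixes [P'] and [Q']. *)
exists (pi (tau l)); split.
- move=> l0; have {l0} tl0 : tau l = 0 by apply: pi_inj.
  have /lP[c E] : divides Q' (Q' * P') by exists P'; rewrite mulrC.
  by move: Q'0; rewrite -Q'P E rmorphM /= tl0 mulr0 eqxx.
- have /lP[g E] := dividesxx l; exists (pi (tau g)).
  apply: (domain_mulI dom wN0).
  transitivity (pi (tau l) * (pi w ^+ N * p)); first by ring.
  by rewrite EP -P'P -!rmorphM E rmorphM Q'P rmorphM /= -EQ; ring.
- move=> x [y E]; have [X XE] := pi_surj x; have [Y YE] := pi_surj y.
  have [M1 K1] := clear_le X; have [M2 K2] := clear_le Y.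
  have [X' [X'P EX]] := K1 _ (leq_maxl M1 M2).
  have [Y' [Y'P EY]] := K2 _ (leq_maxr M1 M2).
  set M := maxn M1 M2 in EX EY; rewrite XE in EX; rewrite YE in EY; exists M.
  have /lP[c cE] : divides Q' (X' * P').
    exists Y'; apply: pi_fixed_inj; rewrite ?rmorphM ?X'P ?P'P ?Y'P ?Q'P //=.
    rewrite -EX -EP -EY -EQ.
    by transitivity (pi w ^+ M * pi w ^+ N * (x * p)); [ring | rewrite E; ring].
  by exists (pi (tau c)); rewrite EX -X'P cE !rmorphM.
Qed.
End Elimination.

Lemma mpoly_morph_eq (k : comNzRingType) (d : nat) (B : comNzRingType)
    (f g : {rmorphism {mpoly k[d]} -> B}) :
  (forall c, f c%:MP = g c%:MP) -> (forall i, f 'X_i = g 'X_i) -> f =1 g.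
Proof.
move=> fgC fgX p; rewrite [p]mpolyE !rmorph_sum /=; apply: eq_bigr => m _.
rewrite -mul_mpolyC !rmorphM /= fgC mpolyXE_id !rmorph_prod /=.
by congr (_ * _); apply: eq_bigr => i _; rewrite !rmorphXn /= fgX.
Qed.

(** * The determinantal ring: elimination of one entry and regular minors *)

Section DetRing.
Variables (k : fieldType) (n' : nat) (n_gt0 : (0 < n'.+1)%N).
Local Notation n := n'.+1.
Local Notation S := {mpoly k[n * n]}.
Local Notation X := (generic_mx k n).
Local Notation R := (det_ring k n_gt0).
Local Open Scope quotient_scope.

Definition det_pi : S -> R := \pi_R.
HB.instance Definition _ := GRing.RMorphism.on det_pi.

Lemma det_pi_surj (r : R) : exists p, det_pi p = r.
Proof. by exists (generic_quotient.repr r); rewrite /det_pi reprK. Qed.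

Lemma det_pi_eq0 p : det_pi p = 0 <-> exists q, p = q * \det X.
Proof.
have := Quotient.idealrBE (det_ideal k n_gt0 : idealr _) p 0; rewrite subr0 => E.
split=> [e|H].
  apply/asboolP; have -> : `[< exists q, p = q * \det X >] = (p \in (det_ideal k n_gt0 : idealr _)) by [].
  by rewrite E -[_ == _]/(det_pi p == det_pi 0) e rmorph0.
apply/eqP; rewrite -(rmorph0 det_pi) -[_ == _]/(p == 0 %[mod R]) -E.
exact/asboolP.
Qed.

Section Substitution.
Variables (i j : 'I_n).
Local Notation z := (mxvec_index i j).
Let w := minor k i j.
Let sgn : S := (-1) ^+ (i + j).
Let rest : S := \sum_(l | l != j) X i l * cofactor X i l.

Let det_row : \det X = sgn * 'X_z * w + rest.
Proof.
rewrite (expand_det_row X i) (bigD1 j) //=; congr (_ + _).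
by rewrite mxE /cofactor mulrA -/w -/sgn [_ * sgn]mulrC.
Qed.

(** This is the retraction [tau] of the elimination; its fixed ring consists of the polynomials free
    of the variable at [(i, j)]. *)
Definition kill_var : S -> S :=
  mmap (@mpolyC _ _) (fun l => if l == z then 0 else 'X_l).
HB.instance Definition _ := GRing.RMorphism.on kill_var.

Let kill_varC c : kill_var c%:MP = c%:MP. Proof. exact: mmapC. Qed.
Let kill_varX l : kill_var 'X_l = if l == z then 0 else 'X_l.
Proof. by rewrite /kill_var mmapX mmap1U. Qed.

Let killK p : kill_var (kill_var p) = kill_var p.
Proof.
apply: (@mpoly_morph_eq _ _ _ (kill_var \o kill_var) kill_var) p => [c|l] /=.
  by rewrite !kill_varC.
by rewrite !kill_varX; case: ifP => [_|e]; rewrite ?rmorph0 // kill_varX e.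
Qed.

Let kill_X a b : (a != i) || (b != j) -> kill_var (X a b) = X a b.
Proof. by move=> ne; rewrite mxE kill_varX idx_eq -[_ && _]negbK negb_and ne. Qed.

Let sub_entry l a b : row' i (col' l X) a b = X (lift i a) (lift l b).
Proof. by rewrite !mxE. Qed.

Let kill_cofactor l : kill_var (cofactor X i l) = cofactor X i l.
Proof.
rewrite /cofactor rmorphM rmorphXn rmorphN1 /=; congr (_ * _).
rewrite -det_map_mx; congr (\det _); apply/matrixP => a b.
by rewrite [LHS]mxE sub_entry; apply: kill_X; rewrite [lift i a == i]eq_sym neq_lift.
Qed.

Let kill_w : kill_var w = w.
Proof.
rewrite /w /minor -det_map_mx; congr (\det _); apply/matrixP => a b.
by rewrite [LHS]mxE sub_entry; apply: kill_X; rewrite [lift i a == i]eq_sym neq_lift.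
Qed.

Let kill_rest : kill_var rest = rest.
Proof.
rewrite /rest rmorph_sum /=; apply: eq_bigr => l lj.
by rewrite rmorphM /= kill_cofactor kill_X // lj orbT.
Qed.

Let sgnK : sgn * sgn = 1.
Proof. by rewrite /sgn -exprD addnn -mul2n exprM sqrrN !expr1n. Qed.

Let kill_sgn : kill_var sgn = sgn.
Proof. by rewrite /sgn rmorphXn rmorphN1. Qed.

Let clear p : exists N p', kill_var p' = p' /\ det_pi (w ^+ N * p) = det_pi p'.
Proof.
pose P p := exists N p', kill_var p' = p' /\ det_pi (w ^+ N * p) = det_pi p'.
have PD x y : P x -> P y -> P (x + y).
  move=> [N [p' [p'P Ep]]] [M [q' [q'P Eq]]]; exists (N + M)%N, (w ^+ M * p' + w ^+ N * q').
  split; first by rewrite rmorphD !rmorphM !rmorphXn /= kill_w p'P q'P.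
  by rewrite rmorphD ![in RHS]rmorphM /= -Ep -Eq -!rmorphM -rmorphD; congr det_pi; rewrite exprD; ring.
have PM x y : P x -> P y -> P (x * y).
  move=> [N [p' [p'P Ep]]] [M [q' [q'P Eq]]]; exists (N + M)%N, (p' * q').
  split; first by rewrite rmorphM /= p'P q'P.
  by rewrite ![in RHS]rmorphM /= -Ep -Eq -!rmorphM; congr det_pi; rewrite exprD; ring.
have PC c : P c%:MP by exists 0%N, c%:MP; rewrite kill_varC mul1r.
have PX l : P 'X_l.
  have [->|ne] := eqVneq l z; last first.
    by exists 0%N, 'X_l; rewrite kill_varX (negPf ne) mul1r.
  (* In [R] the expansion of the determinant along row [i] reads [w * 'X_z = - sgn * rest]. *)
  exists 1%N, (- sgn * rest); split.
    by rewrite rmorphM rmorphN /= kill_sgn kill_rest.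
  apply/eqP; rewrite -subr_eq0 -rmorphB /=; apply/eqP/det_pi_eq0; exists sgn.
  rewrite det_row; transitivity (sgn * sgn * 'X_z * w + sgn * rest); last by ring.
  by rewrite sgnK; ring.
rewrite [p]mpolyE; apply: (big_ind P) => [||m _]; first by rewrite -mpolyC0.
  exact: PD.
rewrite -mul_mpolyC; apply: (PM) => //; rewrite mpolyXE_id.
apply: (big_ind P) => [||l _]; [by rewrite -mpolyC1|exact: PM|].
by elim: (m l) => [|e IH]; [rewrite expr0 -mpolyC1 | rewrite exprS; apply: PM].
Qed.

Hypothesis w_neq0 : w != 0.

(** Solving [\det X = 0] for the variable [z] gives a substitution that kills [\det X] but is
    injective on the polynomials free of that variable. *)
Let theta : S -> {fraction S} :=
  mmap (@tofrac _ \o @mpolyC _ _)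
    (fun l => if l == z then - (tofrac (sgn * rest) / tofrac w) else tofrac 'X_l).
HB.instance Definition _ := GRing.RMorphism.on theta.

Let theta_fixed p : kill_var p = p -> theta p = tofrac p.
Proof.
move=> <-.
apply: (@mpoly_morph_eq _ _ _ (theta \o kill_var) (@tofrac _ \o kill_var)) p => [c|l] /=.
  by rewrite kill_varC /theta mmapC.
rewrite kill_varX; case: ifP => [_|e]; rewrite ?rmorph0 //.
by rewrite /theta mmapX mmap1U e.
Qed.

Let pi_inj p : kill_var p = p -> det_pi p = 0 -> p = 0.
Proof.
move=> pP /det_pi_eq0[q E]; apply/eqP; rewrite -tofrac_eq0 -theta_fixed // E.
suff -> : theta (q * \det X) = 0 by [].
have thz : theta 'X_z = - (tofrac (sgn * rest) / tofrac w).
  by rewrite /theta mmapX mmap1U eqxx.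
rewrite det_row rmorphM rmorphD rmorphM /= (rmorphM theta sgn) /= thz.
rewrite (theta_fixed kill_sgn) (theta_fixed kill_w) (theta_fixed kill_rest) mulrN mulNr -!mulrA mulVf ?tofrac_eq0 // mulr1.
by rewrite -tofracM mulrA sgnK mul1r addNr mulr0.
Qed.

Lemma det_ring_domain :
  (forall N x, det_pi w ^+ N * x = 0 -> x = 0) -> domain R.
Proof. exact: elimination_domain det_pi_surj pi_inj clear. Qed.

Lemma det_pi_minor_neq0 : det_pi w <> 0.
Proof. by move=> /(pi_inj kill_w) E; move: w_neq0; rewrite E eqxx. Qed.

Lemma det_ring_least_denominators : domain R -> least_denominators (det_pi w).
Proof.
move=> dom.
apply: (elimination_least_denominators _ killK kill_w det_pi_surj pi_inj clear dom).
  by move=> a b; apply: ufd_colon; apply: ufd_mpoly.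
exact: det_pi_minor_neq0.
Qed.
End Substitution.

Lemma det_ring_noetherian : noetherian R.
Proof. exact: noetherian_surj det_pi_surj (@noetherian_mpoly k _). Qed.

Local Notation w1 := (minor k ord0 (@ord_max n')).
Local Notation w2 := (minor k (@ord_max n') ord0).

Lemma leading_neq0 d (mf : measure d) e (f : {mpoly k[d]}) m :
  leading mf e f 'X_[m] -> f != 0.
Proof.
case=> _ E; apply/eqP => f0; move: E; rewrite f0 raddf0 => /(congr1 (mcoeff m)).
by rewrite mcoeff0 mcoeffX eqxx => /esym/eqP; rewrite oner_eq0.
Qed.

Lemma minor1_neq0 : w1 != 0.
Proof.
by apply: leading_neq0 (@minor_leading k n' _ _ 0 1 _) => x; rewrite lift0 lift_max addn0 addn1.
Qed.

Lemma minor2_neq0 : w2 != 0.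
Proof.
by apply: leading_neq0 (@minor_leading k n' _ _ 1 0 _) => x; rewrite lift0 lift_max addn0 addn1.
Qed.

Lemma minor_diag_neq0 (i : 'I_n) : minor k i i != 0.
Proof. exact: leading_neq0 (@minor_leading k n' _ _ 0 0 _). Qed.

Lemma det_pi_eq p q : det_pi p = det_pi q <-> exists c, p = q + c * \det X.
Proof.
split=> [E|[c ->]].
  have /det_pi_eq0[c cE] : det_pi (p - q) = 0 by rewrite rmorphB /= E subrr.
  by exists c; rewrite -cE addrC subrK.
rewrite rmorphD /=; suff -> : det_pi (c * \det X) = 0 by rewrite addr0.
by apply/det_pi_eq0; exists c.
Qed.

Lemma det_ring_regular1 N x : det_pi w1 ^+ N * x = 0 -> x = 0.
Proof.
have [p <-] := det_pi_surj x; rewrite -rmorphXn -rmorphM => /det_pi_eq0[q E].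
have : adjoin (eq^~ 0) (\det X) p.
  by apply: (@minors_regular1 k n' N p); exists 0, q; rewrite add0r mulrC E.
by case=> y [s [-> ->]]; apply/det_pi_eq0; exists s; rewrite add0r.
Qed.

Lemma det_ring_regular2 a b x y :
  x * det_pi w2 ^+ b = y * det_pi w1 ^+ a -> exists z, x = z * det_pi w1 ^+ a.
Proof.
have [p <-] := det_pi_surj x; have [q <-] := det_pi_surj y.
rewrite -!rmorphXn -!rmorphM => /det_pi_eq[c E].
have : adjoin (adjoin (eq^~ 0) (\det X)) (w1 ^+ a) p.
  apply: (@minors_regular2 k n' a b p); exists (c * \det X), q.
  by split; [exists 0, c; rewrite add0r | rewrite E addrC].
case=> _ [s [[_ [t [-> ->]]] ->]]; exists (det_pi s).
by rewrite -rmorphM; apply/det_pi_eq; exists t; ring.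
Qed.

Lemma det_ring_regular3 a b c x y z : (0 < c)%N ->
  x * (\sum_i det_pi (minor k i i) ^+ c) = y * det_pi w1 ^+ a + z * det_pi w2 ^+ b ->
  exists y' z', x = y' * det_pi w1 ^+ a + z' * det_pi w2 ^+ b.
Proof.
move=> c0; have [p <-] := det_pi_surj x; have [q <-] := det_pi_surj y.
have [r <-] := det_pi_surj z.
have -> : \sum_i det_pi (minor k i i) ^+ c = det_pi (\sum_i minor k i i ^+ c).
  by rewrite rmorph_sum; apply: eq_bigr => i _; rewrite rmorphXn.
rewrite -!rmorphXn -!rmorphM -rmorphD => /det_pi_eq[e E].
have : adjoin (adjoin (adjoin (eq^~ 0) (\det X)) (w1 ^+ a)) (w2 ^+ b) p.
  apply: (@minors_regular3 k n' a b c c0 p); exists (e * \det X + q * w1 ^+ a), r; split.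
    by exists (e * \det X), q; split=> //; exists 0, e; rewrite add0r.
  by rewrite E; ring.
case=> _ [s [[_ [t [[_ [u [-> ->]]] ->]]] ->]]; exists (det_pi t), (det_pi s).
by rewrite -!rmorphM -rmorphD; apply/det_pi_eq; exists u; ring.
Qed.
End DetRing.

(** * Modules of rank one *)

Section LinearMaps.
Variable R : comNzRingType.
Implicit Types U V : lmodType R.

Definition mk_linear U V (f : U -> V) (fL : linear f) : {linear U -> V} :=
  HB.pack f (GRing.isLinear.Build R U V _ f fL).

(** The device for building linear maps from a relation that determines their values, such as
    division by a nonzero scalar or descent along a surjection. *)
Lemma linear_choice U V (Q : U -> V -> Prop) :
  (forall x, exists y, Q x y) -> (forall x y y', Q x y -> Q x y' -> y = y') ->
  (forall a x x' y y', Q x y -> Q x' y' -> Q (a *: x + x') (a *: y + y')) ->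
  exists f : {linear U -> V}, forall x, Q x (f x).
Proof.
move=> /choice[f fP] uniq Qlin.
have fL : linear f.
  by move=> a x y; apply: uniq (fP _) _; apply: Qlin.
by exists (mk_linear fL).
Qed.

Lemma bijective_inj_surj (S T : Type) (f : S -> T) :
  injective f -> surjective f -> bijective f.
Proof.
move=> fI /choice[g gP]; exists g => // x; apply: fI; exact: gP.
Qed.

Lemma isomorphicP U V : isomorphic U V ->
  exists (f : {linear U -> V}) (g : {linear V -> U}), cancel f g /\ cancel g f.
Proof.
case=> f [g fK gK]; have gL : linear g.
  by move=> a x y; apply: (can_inj fK); rewrite linearP !gK.
by exists f, (mk_linear gL).
Qed.

Lemma isomorphic_sym U V : isomorphic U V -> isomorphic V U.
Proof. by case/isomorphicP=> f [g [fK gK]]; exists g, f. Qed.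

Lemma isomorphic_refl U : isomorphic U U.
Proof. by exists idfun; exists idfun. Qed.

Definition torsion_free U : Prop := forall (a : R) (x : U), a *: x = 0 -> a = 0 \/ x = 0.

Lemma torsion_free_inj U (a : R) (x y : U) :
  torsion_free U -> a <> 0 -> a *: x = a *: y -> x = y.
Proof.
move=> tf a0 /eqP; rewrite -subr_eq0 -scalerBr => /eqP/tf[//|/eqP].
by rewrite subr_eq0 => /eqP.
Qed.

Lemma torsion_free_injr U (a b : R) (x : U) :
  torsion_free U -> x <> 0 -> a *: x = b *: x -> a = b.
Proof.
move=> tf x0 /eqP; rewrite -subr_eq0 -scalerBl => /eqP/tf[/eqP|//].
by rewrite subr_eq0 => /eqP.
Qed.

Definition rank_le1 U : Prop :=
  forall x y : U, exists a b : R, (a <> 0 \/ b <> 0) /\ a *: x = b *: y.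

Lemma has_rank1P U : torsion_free U ->
  has_rank U 1 <-> rank_le1 U /\ exists x : U, x <> 0.
Proof.
move=> tf; split=> [[[v vI] rk]|[rk [x x0]]].
  split; last first.
    exists (v ord0) => v0; have := vI (fun=> 1) _ ord0.
    by rewrite big_ord1 v0 scaler0 => /(_ erefl)/eqP; rewrite oner_eq0.
  move=> x y; apply: contrapT => N.
  suff : (2 <= 1)%N by [].
  pose u (i : 'I_2) := if i == ord0 then x else y.
  apply: (rk 2 u) => a; rewrite big_ord_recl big_ord1 /u /= => /eqP.
  rewrite addr_eq0 -scaleNr => /eqP E.
  have H : ~ (a ord0 <> 0 \/ - a (lift ord0 ord0) <> 0).
    by move=> H; apply: N; exists (a ord0), (- a (lift ord0 ord0)).
  case=> -[|[|//]] lt.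
    rewrite (_ : Ordinal lt = ord0); last exact: val_inj.
    by apply: contrapT => H'; apply: H; left.
  rewrite (_ : Ordinal lt = lift ord0 ord0); last exact: val_inj.
  by apply: contrapT => H'; apply: H; right; move=> /eqP; rewrite oppr_eq0 => /eqP.
split.
  exists (fun=> x) => a; rewrite big_ord1 => /tf[a0 i|//].
  by rewrite ord1.
case=> [|[|m]] // v vI.
have [a [b [ab E]]] := rk (v ord0) (v (lift ord0 ord0)).
pose c (i : 'I_m.+2) := if i == ord0 then a else if i == lift ord0 ord0 then - b else 0.
have c0 : \sum_i c i *: v i = 0.
  rewrite !big_ord_recl big1 => [|i _]; last by rewrite /c /= scale0r.
  by rewrite /c /= addr0 E scaleNr subrr.
have := vI c c0 ord0; have := vI c c0 (lift ord0 ord0); rewrite /c /= => /eqP.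
by rewrite oppr_eq0 => /eqP b0 a0; case: ab.
Qed.

(** Over a domain, a torsion-free module of rank at most 1 embeds in the fraction field, where a
    functional is multiplication by a fixed fraction. *)
Lemma dual_symmetry U (d : {linear U -> R^o}) (x y : U) :
  torsion_free U -> rank_le1 U -> d x *: y = d y *: x.
Proof.
move=> tf /(_ x y)[a [b [ab E]]].
have K : a * d x = b * d y.
  by have := congr1 d E; rewrite !linearZ.
case: ab => [a0|b0].
  by apply: (torsion_free_inj tf a0); rewrite !scalerA K mulrC -[LHS]scalerA -E scalerA mulrC.
by apply: (torsion_free_inj tf b0); rewrite !scalerA -K mulrC -[LHS]scalerA -E scalerA mulrC.
Qed.

Lemma torsion_free_hom U V : torsion_free V -> torsion_free (Hom U V).
Proof.
move=> tf a f E; have [a0|a0] := pselect (a = 0); [by left | right].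
apply: Hom_eqP => x; have /tf[] // : a *: (f : {linear U -> V}) x = 0.
exact: (congr1 (fun g : {linear U -> V} => g x) E).
Qed.
End LinearMaps.

(* For torsion-free M: after inverting w, the module M becomes free of rank at most 1,
   generated by x. *)
Definition locally_free1 (R : comNzRingType) (w : R) (M : lmodType R) : Prop :=
  exists (x : M) (e : {linear M -> R^o}) N, forall m, w ^+ N *: m = e m *: x.

Section LocallyFree.
Variable R : comNzRingType.
Implicit Types M C : lmodType R.

(** The coordinate functional [e] generates the dual locally, with evaluation at [x] as its
    coordinate. *)
Lemma locally_free1_dual (w : R) M : locally_free1 w M -> locally_free1 w (dual_module M).
Proof.
case=> x [e [N E]].
have evL : linear (fun f : dual_module M => (f : {linear M -> R^o}) x : R^o) by [].
exists (e : dual_module M), (mk_linear evL), N => f; apply: Hom_eqP => m /=.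
have := congr1 (f : {linear M -> R^o}) (E m); rewrite !linearZ /= => ->.
by rewrite /GRing.scale /= mulrC.
Qed.

Lemma locally_free1_iso (w : R) M C : isomorphic M C -> locally_free1 w M -> locally_free1 w C.
Proof.
case/isomorphicP=> f [g [fK gK]] [x [e [N E]]].
exists (f x), (e \o g), N => m /=.
transitivity (f (w ^+ N *: g m)); first by rewrite linearZ /= gK.
by rewrite E linearZ.
Qed.

Hypothesis dom : domain R.

(** Locally, [f] multiplies the generator [x] by [e (f x) / w ^+ N]. *)
Lemma locally_free1_endo (w : R) M (f : {linear M -> M}) : locally_free1 w M ->
  exists N r, forall m, w ^+ N *: f m = r *: m.
Proof.
case=> x [e [N E]]; exists (N + N)%N, (e (f x) * w ^+ N) => m.
have -> : w ^+ (N + N) *: f m = w ^+ N *: f (w ^+ N *: m).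
  by rewrite linearZ /= scalerA exprD.
by rewrite (E m) linearZ /= scalerA mulrC -scalerA E scalerA mulrC -!scalerA -E.
Qed.

Variables w1 w2 : R.
Hypothesis w1_neq0 : w1 <> 0.
Hypothesis reg2 : forall a b x y, x * w2 ^+ b = y * w1 ^+ a -> exists z, x = z * w1 ^+ a.

(** The local scalars [r / w1 ^+ a] and [s / w2 ^+ b] are the same fraction, and regularity then
    makes [w1 ^+ a] divide [r]. *)
Lemma scalar_endo M (f : {linear M -> M}) : torsion_free M ->
  locally_free1 w1 M -> locally_free1 w2 M -> exists t, forall m, f m = t *: m.
Proof.
move=> tf /(locally_free1_endo f)[a [r Er]] /(locally_free1_endo f)[b [s Es]].
have [[m0 m0P]|N] := pselect (exists m : M, m <> 0); last first.
  exists 0 => m; rewrite scale0r; have -> : m = 0 by apply: contrapT => m0; apply: N; exists m.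
  by rewrite linear0.
have /reg2[z zE] : r * w2 ^+ b = s * w1 ^+ a.
  apply: (torsion_free_injr tf m0P).
  by rewrite [r * _]mulrC [s * _]mulrC -!scalerA -Er -Es !scalerA mulrC.
exists z => m; apply: (torsion_free_inj tf (domain_expr_neq0 dom (n := a) w1_neq0)).
by rewrite Er zE scalerA mulrC.
Qed.

Lemma Hom_self_isomorphic M : torsion_free M -> (exists m : M, m <> 0) ->
  (forall f : {linear M -> M}, exists t, forall m, f m = t *: m) ->
  isomorphic (Hom M M) R^o.
Proof.
move=> tf [m0 m0P] H.
have [g gP] : exists g : {linear Hom M M -> R^o},
    forall f : Hom M M, forall m, (f : {linear M -> M}) m = g f *: m.
  apply: (@linear_choice R (Hom M M) R^o
    (fun f t => forall m, (f : {linear M -> M}) m = t *: m)) => [//|f t t' H1 H2|a f f' t t' H1 H2 m].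
    by apply: (torsion_free_injr tf m0P); rewrite -H1 -H2.
  by rewrite /= H1 H2 scalerDl scalerA.
exists g; apply: bijective_inj_surj => [f f' E|t].
  apply: Hom_eqP => m; apply: etrans (gP f m) _.
  by apply: etrans (esym (gP f' m)); rewrite E.
have tL : linear (fun m : M => t *: m).
  by move=> a x y; rewrite scalerDr !scalerA mulrC.
exists (mk_linear tL : Hom M M); apply: (torsion_free_injr tf m0P).
exact: esym (gP (mk_linear tL) m0).
Qed.

Hypothesis noeth : noetherian R.

(** [l] is a common denominator of the fractions [c / c0], least up to powers of [w]. If [l1] serves
    for [s] and the next fraction is [p / q], then [l1] is multiplied by the least denominator of
    [l1 * p / q]. *)
Lemma generators_denominator (w : R) C (c0 : C) (s : seq C) :
  least_denominators w -> torsion_free C -> rank_le1 C -> c0 <> 0 ->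
  exists l, [/\ l <> 0, {in s, forall c, exists a, l *: c = a *: c0}
    & forall x, {in s, forall c, exists a, x *: c = a *: c0} ->
      exists N, divides l (w ^+ N * x)].
Proof.
move=> LD tf rk c00; elim: s => [|c s [l1 [l10 l1P l1min]]].
  exists 1; split=> // [/eqP|x _]; first by rewrite oner_eq0.
  by exists 0%N, x; rewrite mul1r mulr1.
have [p [q [pq E]]] := rk c0 c.
have q0 : q <> 0.
  move=> q0; rewrite q0 scale0r in E; case: pq => // p0.
  by case: (tf _ _ E).
have [l2 [l20 [y yE] l2min]] := LD (l1 * p) q q0.
exists (l2 * l1); split.
- by move=> /dom[].
- move=> c'; rewrite inE => /predU1P[->|/l1P[a aE]]; last first.
    by exists (l2 * a); rewrite -scalerA aE scalerA.
  exists y; apply: (torsion_free_inj tf q0).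
  by rewrite scalerA mulrC -scalerA -E !scalerA -mulrA yE mulrC.
- move=> x xP; have [|N [z zE]] := l1min x.
    by move=> c' c's; apply: xP; rewrite inE c's orbT.
  have [a aE] := xP c (mem_head _ _).
  have xpE : x * p = q * a.
    apply: (torsion_free_injr tf c00); rewrite -!scalerA -aE E !scalerA; congr (_ *: _).
    exact: mulrC.
  have [|M [u uE]] := l2min z.
    exists (w ^+ N * a); transitivity (w ^+ N * (x * p)); last by rewrite xpE; ring.
    by rewrite mulrA -zE mulrA.
  exists (M + N)%N, u; rewrite exprD -mulrA zE mulrA uE; ring.
Qed.

(** For a functional [d], [dual_symmetry] makes [d c0] a common denominator of all [c / c0], so the
    least one, [l], divides it up to powers of [w]. Hence [alpha], which sends [c] to [l c / c0],
    generates the dual locally. *)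
Lemma locally_free1_of_dual (w : R) C : finitely_generated C -> torsion_free C -> rank_le1 C ->
  least_denominators w -> locally_free1 w (dual_module C).
Proof.
move=> [m [g gen]] tf rk LD.
have [[c0 c00]|N] := pselect (exists c : C, c <> 0); last first.
  exists 0, [the {linear dual_module C -> R^o} of \0], 0%N => f; rewrite scaler0.
  apply: Hom_eqP => c /=; have -> : c = 0 by apply: contrapT => c0; apply: N; exists c.
  by rewrite linear0 scaler0.
have [l [l0 lP lmin]] := generators_denominator (codom g) LD tf rk c00.
have fin x : {in codom g, forall c, exists a, x *: c = a *: c0} ->
    forall c, exists a, x *: c = a *: c0.
  move=> xP c; have [u ->] := gen c.
  have /choice[v vE] : forall i, exists a, x *: g i = a *: c0.
    by move=> i; apply: xP; apply: codom_f.
  exists (\sum_i u i * v i); rewrite scaler_sumr scaler_suml.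
  by apply: eq_bigr => i _; rewrite -scalerA -vE !scalerA mulrC.
have [alpha alphaE] : exists alpha : {linear C -> R^o}, forall c, l *: c = alpha c *: c0.
  apply: (@linear_choice R C R^o (fun c a => l *: c = a *: c0)); first exact: fin.
    by move=> c a a' -> /(torsion_free_injr tf c00).
  move=> a x x' y y' E E'; rewrite scalerDr scalerA mulrC -scalerA E E'.
  by rewrite scalerDl scalerA.
(* The exponent must not depend on the functional; it is uniform because these ideals form an
   ascending chain in [n]. *)
have [N NP] : exists N, forall n x, divides l (w ^+ n * x) -> divides l (w ^+ N * x).
  apply: (noeth (I := fun n x => divides l (w ^+ n * x))) => [n|n x]; last first.
    by rewrite exprS -mulrA; apply: divides_mull.
  split=> [|x y|a x]; first by rewrite mulr0; apply: divides0.
    by rewrite mulrDr; apply: dividesD.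
  by rewrite mulrCA; apply: divides_mull.
have [e eE] : exists e : {linear dual_module C -> R^o},
    forall d : dual_module C, w ^+ N * (d : {linear C -> R^o}) c0 = e d * l.
  apply: (@linear_choice R (dual_module C) R^o
    (fun d y => w ^+ N * (d : {linear C -> R^o}) c0 = y * l)).
  - move=> d; have [|n nP] := lmin ((d : {linear C -> R^o}) c0).
      by move=> c _; exists ((d : {linear C -> R^o}) c); apply: dual_symmetry.
    by have [y ->] := NP _ _ nP; exists y.
  - move=> d y y' ->; rewrite ![_ * l]mulrC; exact: domain_mulI.
  - move=> a d d' y y' /= E E'; rewrite mulrDr E' mulrDl; congr (_ + _).
    by rewrite mulrCA E mulrA.
exists (alpha : dual_module C), e, N => d; apply: Hom_eqP => c /=.
apply: (domain_mulI dom l0); apply: (torsion_free_injr tf c00).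
have dE := dual_symmetry (d : {linear C -> R^o}) c0 c tf rk.
transitivity ((w ^+ N * (d : {linear C -> R^o}) c0) *: (l *: c)).
  rewrite scalerA [_ * l]mulrC mulrA -!scalerA; do 2 congr (_ *: _).
  by rewrite dE.
by rewrite eE alphaE scalerA; congr (_ *: _); rewrite /GRing.scale /=; ring.
Qed.
End LocallyFree.

(** * Reflexive modules are 1-semidualizing *)

Section Reflexivity.
Variable R : comNzRingType.
Hypothesis dom : domain R.
Implicit Types M C : lmodType R.

Lemma torsion_free_regular : torsion_free R^o.
Proof. by move=> a x; apply: dom. Qed.

Lemma reflexive_torsion_free M : reflexive_module M -> torsion_free M.
Proof.
case=> _ /isomorphicP[f [g [fK _]]] a x E.
have [] := @torsion_free_hom R _ _ torsion_free_regular a (f x).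
- by rewrite -linearZ E linear0.
- by left.
- by move=> /(congr1 g); rewrite fK linear0; right.
Qed.

(* The isomorphism with the bidual need not be the canonical one, but it embeds M
   into the functions on the dual. *)
Lemma reflexive_separated M (x : M) : reflexive_module M ->
  (forall d : {linear M -> R^o}, d x = 0) -> x = 0.
Proof.
case=> _ /isomorphicP[f [g [fK _]]] H.
apply: (can_inj fK); rewrite linear0; apply: Hom_eqP => d /=.
have dL : linear (fun y => (f y : {linear dual_module M -> R^o}) d : R^o).
  by move=> a y z; rewrite linearP.
exact: (H (mk_linear dL)).
Qed.

(** The given isomorphism [f] induces an endomorphism [ev] of the dual, and [x] is chosen with
    [f x = e \o ev]. In rank one [d] and [ev d0] are proportional, so comparing them cancels [ev]
    and leaves evaluation at [x]. *)
Lemma reflexive_biduality M (e : {linear dual_module M -> R^o}) :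
  reflexive_module M -> rank_le1 M ->
  exists x : M, forall d : dual_module M, (d : {linear M -> R^o}) x = e d.
Proof.
move=> refl rk; have tf := reflexive_torsion_free refl.
have [_ /isomorphicP[f [g [fK gK]]]] := refl.
have fdL (d : dual_module M) : linear (fun y => (f y : {linear dual_module M -> R^o}) d : R^o).
  by move=> a y z; rewrite linearP.
pose ev d : dual_module M := mk_linear (fdL d).
have evL : linear (fun d => e (ev d) : R^o).
  move=> a d d'; rewrite -linearP; congr (e _).
  by apply: Hom_eqP => y /=; rewrite linearP.
exists (g (mk_linear evL : dual_module (dual_module M))) => d.
set x := g _.
have xE d' : (f x : {linear dual_module M -> R^o}) d' = e (ev d') by rewrite /x gK.
have [[d0 [y0 y0P]]|N] := pselect (exists d0 y, (ev d0 : {linear M -> R^o}) y <> 0); last first.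
  have M0 y : y = 0 :> M.
    apply: (can_inj fK); rewrite linear0; apply: Hom_eqP => d' /=.
    by apply: contrapT => H; apply: N; exists d', y.
  have -> : d = 0 by apply: Hom_eqP => y /=; rewrite (M0 y) linear0.
  by rewrite linear0.
apply: (domain_mulI dom y0P).
have sym y : (ev d0 : {linear M -> R^o}) y0 * (d : {linear M -> R^o}) y
    = (d : {linear M -> R^o}) y0 * (ev d0 : {linear M -> R^o}) y.
  have := dual_symmetry (ev d0 : {linear M -> R^o}) y0 y tf rk.
  by move=> /(congr1 (d : {linear M -> R^o})); rewrite !linearZ /= /GRing.scale /= => ->; ring.
rewrite sym.
have -> : (ev d0 : {linear M -> R^o}) x = e (ev d0) by exact: xE.
transitivity (e ((d : {linear M -> R^o}) y0 *: ev d0)); first by rewrite linearZ.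
transitivity (e ((ev d0 : {linear M -> R^o}) y0 *: d)); last by rewrite linearZ.
by congr (e _); apply: Hom_eqP => y; rewrite /= -[LHS]sym.
Qed.

(** Every value [d x] is divisible by [v]; the quotients form a functional on the dual, which
    biduality realizes as evaluation at [z]. *)
Lemma reflexive_regular M (u v : R) : reflexive_module M -> rank_le1 M -> v <> 0 ->
  (forall x y, x * u = y * v -> exists z, x = z * v) ->
  forall x y : M, u *: x = v *: y -> exists z, x = v *: z.
Proof.
move=> refl rk v0 uv x y E.
have [e eE] : exists e : {linear dual_module M -> R^o},
    forall d : dual_module M, (d : {linear M -> R^o}) x = e d * v.
  apply: (@linear_choice R (dual_module M) R^o
    (fun d z => (d : {linear M -> R^o}) x = z * v)).
  - move=> d; apply: (uv _ ((d : {linear M -> R^o}) y)).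
    have := congr1 (d : {linear M -> R^o}) E; rewrite !linearZ /= /GRing.scale /=.
    by rewrite mulrC => ->; rewrite mulrC.
  - by move=> d z z' ->; rewrite ![_ * v]mulrC; apply: domain_mulI.
  - move=> a d d' z z' /= E1 E2; rewrite E1 E2 /GRing.scale /=; ring.
have [z zE] := reflexive_biduality e refl rk; exists z.
apply/eqP; rewrite -subr_eq0; apply/eqP/reflexive_separated => // d.
rewrite raddfB /= linearZ /= /GRing.scale /= (eE d) (zE d); ring.
Qed.
End Reflexivity.

(** * Vanishing of self-extensions *)

Section ExtVanishing.
Variable R : comNzRingType.
Hypothesis dom : domain R.
Variables (w1 w2 : R) (I : finType) (w3 : I -> R).
Hypothesis w1_neq0 : w1 <> 0.
Hypothesis reg2 : forall a b x y, x * w2 ^+ b = y * w1 ^+ a -> exists z, x = z * w1 ^+ a.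
Hypothesis reg3 : forall a b c x y z, (0 < c)%N ->
  x * (\sum_i w3 i ^+ c) = y * w1 ^+ a + z * w2 ^+ b ->
  exists y' z', x = y' * w1 ^+ a + z' * w2 ^+ b.

Variable C : lmodType R.
Hypothesis tf : torsion_free C.
Hypothesis lf1 : locally_free1 w1 C.
Hypothesis lf2 : locally_free1 w2 C.
Hypothesis lf3 : forall i, locally_free1 (w3 i) C.
Hypothesis regC : forall a b (x y : C),
  w2 ^+ b *: x = w1 ^+ a *: y -> exists z, x = w1 ^+ a *: z.

Section Cocycle.
Variables (P : projective_resolution C) (f : {linear P 1%N -> C}).
Hypothesis fP : cocycle f.

Lemma cocycle_ker x y : res_d P 0 x = res_d P 0 y -> f x = f y.
Proof.
move=> E; apply/eqP; rewrite -subr_eq0 -raddfB; apply/eqP.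
have /res_exact[z <-] : res_d P 0 (x - y) = 0 by rewrite raddfB /= E subrr.
exact: fP.
Qed.

Lemma ker_aug_lift p : res_aug P p = 0 -> exists x, res_d P 0 x = p.
Proof. by move/res_exact0. Qed.

(** Locally at [w], lifting the generator [c] to [b] splits the augmentation. Subtracting this
    splitting projects [P 0] to the first syzygy, on which [f] is defined. *)
Lemma cocycle_multiple (w : R) : locally_free1 w C ->
  exists N (g : {linear P 0%N -> C}), forall x, g (res_d P 0 x) = w ^+ N *: f x.
Proof.
case=> c [e [N E]]; have [b bE] := res_aug_surj P c.
exists N.
have [g gP] : exists g : {linear P 0%N -> C}, forall p, exists x,
    res_d P 0 x = w ^+ N *: p - e (res_aug P p) *: b /\ g p = f x.
  apply: (@linear_choice R (P 0%N) C (fun p y => exists x,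
    res_d P 0 x = w ^+ N *: p - e (res_aug P p) *: b /\ y = f x)).
  - move=> p; have [|x xE] := @ker_aug_lift (w ^+ N *: p - e (res_aug P p) *: b).
      by rewrite raddfB /= !linearZ /= bE E scalerN subrr.
    by exists (f x), x.
  - move=> p y y' [x [xE ->]] [x' [xE' ->]].
    by apply: cocycle_ker; rewrite xE.
  - move=> a p p' y y' [x [xE ->]] [x' [xE' ->]]; exists (a *: x + x').
    split; last by rewrite linearP.
    rewrite linearP xE xE' (linearP (res_aug P)) (linearP e) scalerBr scalerDr.
    rewrite scalerDl opprD [RHS]addrACA; congr (_ - _ + _); rewrite !scalerA //.
    by rewrite mulrC.
exists g => x; have [y [yE ->]] := gP (res_d P 0 x).
rewrite -linearZ; apply: cocycle_ker; rewrite yE linearZ /=.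
have -> : res_aug P (res_d P 0 x) = 0 by apply/res_exact0; exists x.
by rewrite linear0 scale0r addr0 linearZ.
Qed.

(* A map g on P 0 that is divisible by v on cocycles induces C -> C / v C, which is
   multiplication by a scalar locally at w. *)
Lemma locally_scalar_mod (v w : R) (g : {linear P 0%N -> C}) :
  (forall x, g (res_d P 0 x) = v *: f x) -> locally_free1 w C ->
  exists N r, forall p, exists z, w ^+ N *: g p = r *: res_aug P p + v *: z.
Proof.
move=> gf [c [e [N E]]]; have [b bE] := res_aug_surj P c.
exists (N + N)%N, (e (g b) * w ^+ N) => p.
have [|x xE] := @ker_aug_lift (w ^+ N *: p - e (res_aug P p) *: b).
  by rewrite raddfB /= !linearZ /= bE E scalerN subrr.
have H : w ^+ N *: g p = e (res_aug P p) *: g b + v *: f x.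
  by rewrite -gf xE (linearB g) !(linearZ_LR g) addrC subrK.
exists (w ^+ N *: f x).
rewrite exprD -scalerA H scalerDr; congr (_ + _); last by rewrite !scalerA mulrC.
rewrite -[RHS]scalerA (E (res_aug P p)) [LHS]scalerA mulrC -[LHS]scalerA (E (g b)).
by rewrite !scalerA mulrC.
Qed.

Lemma locally_scalar_mod_le (v w : R) (g : {linear P 0%N -> C}) :
  (forall x, g (res_d P 0 x) = v *: f x) -> locally_free1 w C ->
  exists N, forall M, (N <= M)%N ->
    exists r, forall p, exists z, w ^+ M *: g p = r *: res_aug P p + v *: z.
Proof.
move=> gf /(locally_scalar_mod gf)[N [r rP]]; exists N => M /subnK <-.
exists (w ^+ (M - N) * r) => p; have [z zE] := rP p; exists (w ^+ (M - N) *: z).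
by rewrite exprD -scalerA zE scalerDr !scalerA [v * _]mulrC.
Qed.

Lemma cocycle_coboundary : coboundary f.
Proof.
have [[m0 m0P]|C0] := pselect (exists m : C, m <> 0); last first.
  exists [the {linear P 0%N -> C} of \0] => x /=.
  by apply: contrapT => fx; apply: C0; exists (f x).
(* It remains to correct [g] by a multiple of the augmentation so that it becomes divisible by
   [v]. *)
have [a [g gf]] := cocycle_multiple lf1.
set v := w1 ^+ a in gf; have v0 : v <> 0 by apply: domain_expr_neq0.
have [b [r rP]] := locally_scalar_mod gf lf2.
have /choice[K KP] : forall i, exists N, forall M, (N <= M)%N ->
    exists r, forall p, exists z, w3 i ^+ M *: g p = r *: res_aug P p + v *: z.
  by move=> i; apply: locally_scalar_mod_le.
(* One exponent for all [i]; the successor makes it positive, as [reg3] requires. *)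
pose c := (\max_i K i).+1.
have /choice[r3 r3P] : forall i, exists r, forall p, exists z,
    w3 i ^+ c *: g p = r *: res_aug P p + v *: z.
  by move=> i; apply: KP; apply: leqW; apply: leq_bigmax.
pose s := \sum_i r3 i; pose u := \sum_i w3 i ^+ c.
have sP p : exists z, u *: g p = s *: res_aug P p + v *: z.
  have /choice[z zE] : forall i, exists z, w3 i ^+ c *: g p = r3 i *: res_aug P p + v *: z.
    by move=> i; apply: r3P.
  exists (\sum_i z i); rewrite !scaler_suml scaler_sumr -big_split.
  by apply: eq_bigr => i _; apply: zE.
(* Modulo [v], both [r / w2 ^+ b] and [s / u] describe [g], so [u * r - w2 ^+ b * s] maps [C] into
   [v C]. Dividing by [v] gives an endomorphism, hence a scalar [t]. *)
have [psi psiE] : exists psi : {linear C -> C}, forall m,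
    (u * r - w2 ^+ b * s) *: m = v *: psi m.
  apply: (@linear_choice R C C (fun m y => (u * r - w2 ^+ b * s) *: m = v *: y)).
  - move=> m; have [p <-] := res_aug_surj P m.
    have [z zE] := rP p; have [y yE] := sP p; exists (w2 ^+ b *: y - u *: z).
    rewrite scalerBl -!scalerA.
    have -> : r *: res_aug P p = w2 ^+ b *: g p - v *: z by rewrite zE addrK.
    have -> : s *: res_aug P p = u *: g p - v *: y by rewrite yE addrK.
    rewrite !scalerBr !scalerA [w2 ^+ b * u]mulrC [u * v]mulrC [w2 ^+ b * v]mulrC.
    by rewrite opprB addrC addrA subrK.
  - by move=> m y y' -> /(torsion_free_inj tf v0).
  - move=> x m m' y y' E E'; rewrite scalerDr E' scalerA mulrC -scalerA E.
    by rewrite scalerDr !scalerA mulrC.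
have [t tE] := scalar_endo dom w1_neq0 reg2 psi tf lf1 lf2.
have urE : r * u = s * w2 ^+ b + t * v.
  apply: (torsion_free_injr tf m0P); rewrite scalerDl.
  rewrite [t * v]mulrC -[(v * t) *: _]scalerA -tE -psiE -scalerDl; congr (_ *: _); ring.
(* Thus [r] is [z * w2 ^+ b] modulo [v], and [z] is the scalar that glues the local ones. *)
have [y [z rE]] : exists y z, r = y * w1 ^+ a + z * w2 ^+ b.
  by apply: (@reg3 a b c r t s) => //; rewrite -/u urE addrC.
(* After multiplication by [w2 ^+ b] the left side is a multiple of [v]; [regC] removes that
   factor. *)
have [g' g'E] : exists g' : {linear P 0%N -> C}, forall p,
    g p - z *: res_aug P p = v *: g' p.
  apply: (@linear_choice R (P 0%N) C (fun p q => g p - z *: res_aug P p = v *: q)).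
  - move=> p; have [q qE] := rP p.
    apply: (@regC a b _ (y *: res_aug P p + q)).
    rewrite scalerBr qE rE -/v scalerDl scalerDr !scalerA [w2 ^+ b * z]mulrC.
    by rewrite [y * v]mulrC [in LHS]addrAC addrK.
  - by move=> p q q' -> /(torsion_free_inj tf v0).
  - move=> x p p' q q' E E'; rewrite (linearP g) (linearP (res_aug P)).
    rewrite scalerDr opprD addrACA E' scalerA mulrC -scalerA -scalerBr E.
    by rewrite scalerDr !scalerA mulrC.
exists g' => x; apply: (torsion_free_inj tf v0); rewrite -g'E gf.
have -> : res_aug P (res_d P 0 x) = 0 by apply/res_exact0; exists x.
by rewrite scaler0 subr0.
Qed.
End Cocycle.

Lemma Ext1_self_eq0 : Ext_eq0 1 C C.
Proof. by move=> P f fP; apply: cocycle_coboundary. Qed.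
End ExtVanishing.

(** * Free resolutions *)

Section FreeModules.
Variable R : comNzRingType.
Implicit Types (M N : lmodType R) (K : choiceType).

Definition free_module K : lmodType R := {freeg K / R}.

Definition free_gen K (x : K) : free_module K := << x >>.

Lemma free_moduleE K (D : free_module K) :
  exists (s : seq K) (a : K -> R), D = \sum_(x <- s) a x *: free_gen x.
Proof.
exists (dom D), (fun x => coeff x D); rewrite -[LHS]freeg_sumE; apply: eq_bigr => x _.
by apply/eqP/freeg_eqP => y; rewrite coeffZ !coeffU mul1r.
Qed.

Lemma free_lift K M (f : K -> M) :
  exists F : {linear free_module K -> M}, forall x, F (free_gen x) = f x.
Proof.
have FD : additive (fglift f) by exact: lift_is_additive.
pose F0 : {additive free_module K -> M} := HB.pack (fglift f) (GRing.isZmodMorphism.Build _ _ (fglift f) FD).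
have FU a x : F0 (a *: free_gen x) = a *: f x.
  have -> : a *: free_gen x = << a *g x >>.
    by apply/eqP/freeg_eqP => y; rewrite coeffZ !coeffU mul1r.
  by rewrite /F0 /= liftU.
have FZ a D : F0 (a *: D) = a *: F0 D.
  have [s [c ->]] := free_moduleE D.
  rewrite scaler_sumr (raddf_sum F0) (raddf_sum F0) scaler_sumr; apply: eq_bigr => x _.
  by rewrite scalerA !FU scalerA.
have FL : linear (F0 : free_module K -> M) by move=> a x y; rewrite raddfD FZ.
by exists (mk_linear FL) => x; have := FU 1 x; rewrite !scale1r.
Qed.

Lemma free_module_eq K M (F G : {linear free_module K -> M}) :
  (forall x, F (free_gen x) = G (free_gen x)) -> F =1 G.
Proof.
move=> E D; have [s [a ->]] := free_moduleE D; rewrite !linear_sum.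
by apply: eq_bigr => x _; rewrite !linearZ /= E.
Qed.

Lemma free_module_projective K : projective_module (free_module K).
Proof.
move=> M N p f pS.
have /choice[m mE] : forall x : K, exists m, p m = f (free_gen x) by move=> x; apply: pS.
have [g gE] := free_lift m; exists g.
apply: (@free_module_eq K N (p \o g) f) => x /=.
by rewrite gE mE.
Qed.
End FreeModules.

Section Kernels.
Variables (R : comNzRingType) (U V : lmodType R) (f : {linear U -> V}).

Definition ker_pred : {pred U} := fun x => f x == 0.

Fact ker_pred_closed : submod_closed ker_pred.
Proof.
split; first by rewrite unfold_in linear0.
move=> a x y; rewrite !unfold_in => /eqP fx /eqP fy.
by rewrite linearP fx fy scaler0 addr0.
Qed.

HB.instance Definition _ := GRing.isSubmodClosed.Build R U ker_pred ker_pred_closed.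

Record ker_mod := KerMod { ker_val : U; _ : ker_val \in ker_pred }.
HB.instance Definition _ := [isSub for ker_val].
HB.instance Definition _ := [Choice of ker_mod by <:].
HB.instance Definition _ := [SubChoice_isSubLmodule of ker_mod by <:].

Lemma ker_valP (x : ker_mod) : f (val x) = 0.
Proof. by case: x => x /=; rewrite unfold_in => /eqP. Qed.

Lemma ker_val_linear : linear (fun x : ker_mod => val x).
Proof. by move=> a x y; rewrite linearP. Qed.

Lemma ker_val_surj x : f x = 0 -> exists y : ker_mod, val y = x.
Proof.
move=> fx; have kx : x \in ker_pred by rewrite unfold_in fx.
by exists (KerMod kx).
Qed.
End Kernels.

Section FreeResolution.
Variable R : comNzRingType.
Implicit Type M : lmodType R.

(** The basis consists of all elements of [M], so any function on [M], linear or not, gives a linear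
    map on the cover. *)
Definition free_cover M : {linear free_module R M -> M} := sval (cid (free_lift (@idfun M))).

Lemma free_coverE M x : free_cover M (free_gen R x) = x.
Proof. by rewrite /free_cover; case: cid => F FE /=; apply: FE. Qed.

Definition syzygy M : lmodType R := ker_mod (free_cover M).

Definition syzygy_val M : {linear syzygy M -> free_module R M} :=
  mk_linear (@ker_val_linear R _ _ (free_cover M)).

Definition free_res_obj M i : lmodType R := free_module R (iter i syzygy M).

Definition free_res_d M i : {linear free_res_obj M i.+1 -> free_res_obj M i} :=
  syzygy_val (iter i syzygy M) \o free_cover (iter i.+1 syzygy M).

Lemma free_cover_surj M : surjective (free_cover M).
Proof. by move=> x; exists (free_gen R x); apply: free_coverE. Qed.

Lemma syzygy_exact M (x : free_module R M) :
  free_cover M x = 0 <->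
  exists y, (syzygy_val M \o free_cover (syzygy M)) y = x.
Proof.
split=> [/ker_val_surj[y yE]|[y <-]].
  by have [z zE] := free_cover_surj y; exists z; rewrite /= zE.
exact: ker_valP.
Qed.

Lemma free_res_exact M i (x : free_res_obj M i.+1) :
  free_res_d M i x = 0 <-> exists y, free_res_d M i.+1 y = x.
Proof.
rewrite -syzygy_exact /free_res_d /=; have v0 : syzygy_val (iter i syzygy M) 0 = 0 by rewrite linear0.
split=> [E|->]; last exact: v0.
by apply: val_inj; rewrite [LHS]E; apply/esym/v0.
Qed.

(** The hypothesis [Ext_eq0], a condition on all resolutions, is applied to this one. *)
Definition free_resolution M : projective_resolution M :=
  ProjectiveResolution (res_obj := free_res_obj M) (res_d := free_res_d M)
    (res_aug := free_cover M) (fun i => @free_module_projective R _)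
    (@free_cover_surj M) (@syzygy_exact M) (@free_res_exact M).
End FreeResolution.

(** * 1-semidualizing modules are reflexive of rank one *)

Section PrimeIdeals.
Variable R : comNzRingType.
Implicit Types (p : R -> Prop) (C : lmodType R).

Definition prime_ideal p : Prop :=
  [/\ is_ideal p, ~ p 1 & forall a b, p (a * b) -> p a \/ p b].

Lemma ideal_sum p (I : finType) (P : pred I) (F : I -> R) : is_ideal p ->
  (forall i, P i -> p (F i)) -> p (\sum_(i | P i) F i).
Proof. by move=> [p0 pD _] H; apply: big_ind. Qed.

Lemma prime_ideal_prod p (I : finType) (P : pred I) (F : I -> R) : prime_ideal p ->
  (forall i, P i -> ~ p (F i)) -> ~ p (\prod_(i | P i) F i).
Proof.
move=> [_ p1 pM] H; apply: (big_ind (fun x => ~ p x)) => // x y px py.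
by case/pM.
Qed.

Lemma det_mod_ideal p m (A : 'M[R]_m) : is_ideal p ->
  (forall i j, i != j -> p (A i j)) -> p (\det A - \prod_i A i i).
Proof.
move=> pI H; have [p0 pD pM] := pI.
rewrite /determinant (bigD1 1%g) //= odd_perm1 expr0 mul1r.
rewrite (eq_bigr (fun i => A i i)) => [|i _]; last by rewrite perm1.
rewrite addrAC subrr add0r; apply: ideal_sum => // s s1.
have [i si] : exists i, s i != i.
  apply: contrapT => N; case/eqP: s1; apply/permP => i; rewrite perm1.
  by apply/eqP/negPn/negP => si; apply: N; exists i.
by rewrite (bigD1 i) //= mulrCA mulrC; apply/pM/H; rewrite eq_sym.
Qed.

Lemma det_annihilates C m (A : 'M[R]_m) (g : 'I_m -> C) :
  (forall i, \sum_j A i j *: g j = 0) -> forall j, \det A *: g j = 0.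
Proof.
move=> H j.
have adjE l : \sum_i (\adj A j i * A i l) = (\det A) *+ (j == l).
  have /matrixP/(_ j l) := mul_adj_mx A; rewrite !mxE => <-.
  by apply: eq_bigr.
transitivity (\sum_l ((\det A) *+ (j == l)) *: g l).
  rewrite (bigD1 j) //= eqxx big1 ?addr0 // => l ne.
  by rewrite eq_sym (negPf ne) scale0r.
transitivity (\sum_l \sum_i (\adj A j i * A i l) *: g l).
  by apply: eq_bigr => l _; rewrite -adjE scaler_suml.
rewrite exchange_big big1 //= => i _.
under eq_bigr do rewrite -scalerA.
by rewrite -scaler_sumr H scaler0.
Qed.

(* The fibre of C at the prime p is nonzero by the determinant trick, hence has a nonzero
   functional; b is such a functional after clearing denominators, with values in R / p. *)
Lemma functional_mod_prime C p : finitely_generated C ->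
  (forall a : R, (forall c : C, a *: c = 0) -> a = 0) -> prime_ideal p ->
  exists b : C -> R,
    (forall a x y, p (b (a *: x + y) - (a * b x + b y))) /\ exists c, ~ p (b c).
Proof.
move=> [m [g gen]] faith pP; have [pI p1 pM] := pP; have [p0 pD pZ] := pI.
(* This is independence over [R / p] of the generators in [I] as elements of [C / p C]. *)
pose indep (I : {set 'I_m}) := `[< forall a : 'I_m -> R, (forall i, i \notin I -> p (a i)) ->
  \sum_i a i *: g i = 0 -> forall i, p (a i) >].
have indep0 : indep set0 by apply/asboolP => a H _ i; apply: H; rewrite inE.
have [I /maxsetP[/asboolP Iind Imax] _] := @maxset_exists _ indep set0 indep0.
(* By maximality of [I], every other generator depends on those in [I] modulo [p], with its own
   coefficient outside [p]. *)
have relP j : exists a : 'I_m -> R, j \notin I ->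
    [/\ \sum_i a i *: g i = 0, ~ p (a j) & forall i, i != j -> i \notin I -> p (a i)].
  have [jI|jI] := boolP (j \in I); first by exists (fun=> 0).
  apply: contrapT => N.
  have : indep (j |: I).
    apply/asboolP => a H E.
    have [pj|pj] := pselect (p (a j)).
      apply: Iind E => i iI; have [->//|ne] := eqVneq i j.
      by apply: H; rewrite !inE (negPf ne).
    case: N; exists a => _; split=> // i ne iI; apply: H.
    by rewrite !inE (negPf ne).
  move=> /Imax/(_ (subsetUr _ _)) E; move: jI; rewrite -E.
  by rewrite !inE eqxx.
have {relP} /choice[rel relP] := relP.
(* If [I] were empty, these relations would form a matrix that is diagonal modulo [p] with diagonal
   entries outside [p]. Its determinant annihilates [C], so it is zero by faithfulness, yet it is
   not in [p]. *)
have [i0 i0I] : exists i0, i0 \in I.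
  apply: contrapT => N.
  have nI j : j \notin I by apply/negP => jI; apply: N; exists j.
  pose A := \matrix_(i, j) rel i j.
  have dA : \det A = 0.
    apply: faith => c; have [u ->] := gen c; rewrite scaler_sumr big1 // => j _.
    rewrite scalerA mulrC -scalerA (@det_annihilates C m A g) ?scaler0 // => i.
    have [E _ _] := relP i (nI i); rewrite -[RHS]E.
    by apply: eq_bigr => l _; rewrite mxE.
  apply: (@prime_ideal_prod p 'I_m predT (fun i => A i i) pP).
    by move=> i _; rewrite mxE; case: (relP i (nI i)).
  have := @det_mod_ideal p m A pI; rewrite dA sub0r => H.
  rewrite -[\prod_i _]opprK -mulN1r; apply/pZ/H => i j ij.
  by rewrite mxE; case: (relP i (nI i)) => _ _; apply; rewrite // eq_sym.
(* A common denominator: [s *: g j] has coordinates [B j] that lie in [p] outside [I]. *)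
pose s := \prod_(j | j \notin I) rel j j.
have sN : ~ p s by apply: prime_ideal_prod => // j /relP[].
have BP j : exists B : 'I_m -> R, s *: g j = \sum_i B i *: g i /\
    (forall i, i \notin I -> p (B i)) /\ (j \in I -> forall i, B i = s *+ (i == j)).
  have [jI|jI] := boolP (j \in I).
    exists (fun i => s *+ (i == j)); split.
      rewrite (bigD1 j) //= eqxx big1 ?addr0 // => i /negPf ->.
      by rewrite scale0r.
    by split=> // i iI; case: eqP => // e; rewrite -e (negPf iI) in jI.
  have [rE rj rI] := relP j jI.
  pose t := \prod_(l | (l \notin I) && (l != j)) rel l l.
  exists (fun i => if i == j then 0 else - (t * rel j i)); split.
    rewrite (bigD1 j) //= eqxx scale0r add0r.
    have -> : s = t * rel j j by rewrite /s (bigD1 j) //= mulrC.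
    have : rel j j *: g j = - \sum_(i | i != j) rel j i *: g i.
      by move: rE; rewrite (bigD1 j) //= => /eqP; rewrite addr_eq0 => /eqP.
    rewrite -scalerA => ->; rewrite scalerN scaler_sumr -sumrN; apply: eq_bigr => i /negPf ->.
    by rewrite scaleNr scalerA.
  split=> [i iI|//].
  by case: eqP => // /eqP ne; rewrite -mulNr; apply/pZ/rI.
have {BP} /choice[B BP] := BP.
have key (x : 'I_m -> R) : \sum_j x j *: g j = 0 -> p (\sum_j x j * B j i0).
  move=> E; apply: (Iind (fun i => \sum_j x j * B j i)).
    move=> i iI; apply: ideal_sum => // j _; have [_ [BI _]] := BP j.
    exact/pZ/BI.
  transitivity (s *: \sum_j x j *: g j); last by rewrite E scaler0.
  rewrite scaler_sumr; under eq_bigr do rewrite scaler_suml.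
  rewrite exchange_big; apply: eq_bigr => j _ /=; have [BE _] := BP j.
  rewrite scalerA mulrC -scalerA BE scaler_sumr; apply: eq_bigr => i _.
  by rewrite scalerA.
have /choice[x xE] : forall c, exists x : 'I_m -> R, c = \sum_j x j *: g j by exact: gen.
(* The chosen coefficients [x c] need not be linear in [c], but by [key] the coordinate at [i0] is
   well defined modulo [p]. At [g i0] it is [s], which is not in [p]. *)
exists (fun c => \sum_j x c j * B j i0); split.
  move=> a c d.
  have -> : \sum_j x (a *: c + d) j * B j i0
      - (a * \sum_j x c j * B j i0 + \sum_j x d j * B j i0)
    = \sum_j (x (a *: c + d) j - (a * x c j + x d j)) * B j i0.
    rewrite mulr_sumr -big_split -sumrB; apply: eq_bigr => j _ /=; ring.
  apply: key; under eq_bigr do rewrite scalerBl scalerDl -scalerA.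
  rewrite sumrB big_split /= -scaler_sumr -!xE.
  by rewrite subrr.
exists (g i0) => H.
have : p (\sum_j (x (g i0) j - (j == i0)%:R) * B j i0).
  apply: key; under eq_bigr do rewrite scalerBl.
  rewrite sumrB -xE (bigD1 i0) //= eqxx scale1r big1 ?addr0 ?subrr // => j /negPf ->.
  by rewrite scale0r.
have -> : \sum_j (x (g i0) j - (j == i0)%:R) * B j i0 = \sum_j x (g i0) j * B j i0 - s.
  under eq_bigr do rewrite mulrBl.
  rewrite sumrB; congr (_ - _); rewrite (bigD1 i0) //= eqxx mul1r big1 => [|j /negPf ->].
    by rewrite addr0; have [_ [_ ->]] := BP i0; rewrite ?eqxx.
  by rewrite mul0r.
move=> H'; apply: sN; have := is_idealB pI H H'; congr p; ring.
Qed.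
End PrimeIdeals.

(** * Torsion, rank and biduality of a 1-semidualizing module *)

Section Semidualizing.
Variable R : comNzRingType.
Hypothesis dom : domain R.
Hypothesis noeth : noetherian R.
Variable C : lmodType R.

(* A maximal ideal among these is prime. *)
Lemma associated_prime (M : lmodType R) (N : M -> Prop) (Q : M -> Prop) (x0 : M) :
  N 0 -> (forall a x y, N x -> N y -> N (a *: x + y)) ->
  (forall a x, Q x -> ~ N (a *: x) -> Q (a *: x)) -> Q x0 -> ~ N x0 ->
  exists x, [/\ Q x, ~ N x & prime_ideal (fun a => N (a *: x))].
Proof.
move=> N0 NL QZ Qx0 Nx0.
have NZ a x : N x -> N (a *: x) by move=> Nx; rewrite -[_ *: _]addr0; apply: NL.
have idl x : is_ideal (fun a => N (a *: x)).
  split=> [|a b Na Nb|a b Nb]; first by rewrite scale0r.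
    by rewrite scalerDl -[a *: x]scale1r; apply: NL.
  by rewrite -scalerA; apply: NZ.
pose F (I : R -> Prop) := exists x, [/\ Q x, ~ N x & I = fun a => N (a *: x)].
have [||I [[x [Qx Nx ->]] xmax]] := @noetherian_max R F (fun a => N (a *: x0)) noeth.
- by move=> _ [x [_ _ ->]].
- by exists x0.
exists x; split=> //; split=> //; first by rewrite scale1r.
move=> a b Nab; have [Na|Na] := pselect (N (a *: x)); [by left | right].
apply: (xmax (fun b => N (b *: (a *: x)))).
- by exists (a *: x); split=> //; apply: QZ.
- by move=> c Nc; rewrite scalerA mulrC -scalerA; apply: NZ.
- by rewrite scalerA mulrC.
Qed.

Hypothesis Cfg : finitely_generated C.
Hypothesis Cend : isomorphic (Hom C C) R^o.

(** The isomorphism need not match the identity with 1. If [f0] corresponds to 1, then the identity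
    is [r] times [f0] and [f0 \o f0] is [s] times [f0], so [f0] itself is multiplication by [s]. *)
Lemma endo_scalar (f : {linear C -> C}) : exists t, forall c, f c = t *: c.
Proof.
have [F [G [FK GK]]] := isomorphicP Cend.
pose f0 : {linear C -> C} := G 1.
have GE t c : (G t : {linear C -> C}) c = t *: f0 c.
  have tE : t = t *: (1 : R^o) by rewrite /GRing.scale /= mulr1.
  by rewrite [in LHS]tE linearZ_LR.
have FE (h : {linear C -> C}) c : h c = F h *: f0 c by rewrite -GE FK.
pose r : R := F idfun; pose s : R := F (f0 \o f0).
have rE c : c = r *: f0 c by apply: (FE idfun).
have sE c : f0 (f0 c) = s *: f0 c by apply: (FE (f0 \o f0)).
exists (F f * s) => c; rewrite FE -scalerA; congr (_ *: _).
transitivity (f0 (r *: f0 c)); first by rewrite -rE.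
by rewrite linearZ /= sE scalerA mulrC -scalerA -rE.
Qed.

Lemma endo_faithful (a : R) : (forall c : C, a *: c = 0) -> a = 0.
Proof.
have [F [G [FK GK]]] := isomorphicP Cend => aC.
have : a *: (1 : R^o) = 0.
  rewrite -(GK (a *: 1)) linearZ_LR; have -> : a *: G 1 = 0; last by rewrite linear0.
  by apply: Hom_eqP => c /=; rewrite aC.
by rewrite /GRing.scale /= mulr1.
Qed.

(** Take [t] killed by [a0], with prime annihilator [p]. A nonzero functional [b] to [R / p] yields
    a nonzero endomorphism [b c *: t]; but [a0] kills it, so its scalar is zero. *)
Lemma semidualizing_torsion_free : torsion_free C.
Proof.
move=> a0 c0 E; have [//|a00] := pselect (a0 = 0); first by left.
right; apply: contrapT => c00.
have [|||t [Qt tN pP]] := @associated_prime C (fun c => c = 0) (fun c => a0 *: c = 0) c0 _ _ _ E c00.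
- by [].
- by move=> a x y -> ->; rewrite scaler0 addr0.
- by move=> a x Qx _; rewrite scalerA mulrC -scalerA Qx scaler0.
have [b [bL [c1 bc1]]] := functional_mod_prime Cfg endo_faithful pP.
have fL : linear (fun c => b c *: t).
  move=> a x y; apply/eqP; rewrite -subr_eq0 scalerA -scalerDl -scalerBl.
  exact/eqP/bL.
have [r rE] := endo_scalar (mk_linear fL).
have r0 : r = 0.
  have /(domain_mulI dom a00) : a0 * r = a0 * 0; last by [].
  rewrite mulr0; apply: endo_faithful => c; rewrite -scalerA -rE /=.
  by rewrite scalerA mulrC -scalerA Qt scaler0.
by apply: bc1; have := rE c1; rewrite r0 scale0r.
Qed.

Lemma semidualizing_functional :
  exists (b : {linear C -> R^o}) c, b c <> 0.
Proof.
have pP : prime_ideal (fun a : R => a = 0).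
  split=> [|/eqP|]; [|by rewrite oner_eq0|exact: dom].
  by split=> // [x y -> ->|a x ->]; rewrite ?addr0 ?mulr0.
have [b [bL [c1 bc1]]] := functional_mod_prime Cfg endo_faithful pP.
have fL : linear (b : C -> R^o).
  by move=> a x y; apply/eqP; rewrite -subr_eq0; apply/eqP/bL.
by exists (mk_linear fL), c1.
Qed.

(** For fixed [y] the endomorphism [b c *: y] is a scalar; evaluated at [c1], it makes [y]
    proportional to [c1]. *)
Lemma semidualizing_rank_le1 : rank_le1 C.
Proof.
have tf := semidualizing_torsion_free.
have [b [c1 bc1]] := semidualizing_functional.
have H y : exists r, b c1 *: y = r *: c1.
  have fL : linear (fun c => b c *: y).
    by move=> a u v; rewrite linearP scalerDl scalerA.
  by have [r rE] := endo_scalar (mk_linear fL); exists r; apply: (rE c1).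
move=> x y; have [r rE] := H x; have [s sE] := H y.
have [r0|r0] := pselect (r = 0).
  exists 1, 0; split; first by left; apply/eqP/oner_neq0.
  apply: (torsion_free_inj tf bc1); rewrite scale1r rE r0.
  by rewrite !scale0r scaler0.
exists (s * b c1), (r * b c1); split; first by right => /dom[].
by rewrite -!scalerA rE sE !scalerA mulrC.
Qed.

Variables w1 w2 : R.
Hypothesis w1_neq0 : w1 <> 0.
Hypothesis reg2 : forall a b x y, x * w2 ^+ b = y * w1 ^+ a -> exists z, x = z * w1 ^+ a.
Hypothesis LD1 : least_denominators w1.
Hypothesis LD2 : least_denominators w2.

Lemma biduality_inj (c : C) : (forall d : {linear C -> R^o}, d c = 0) -> c = 0.
Proof.
move=> H; have [b [c1 bc1]] := semidualizing_functional.
have tf := semidualizing_torsion_free.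
have := dual_symmetry b c1 c tf semidualizing_rank_le1.
by rewrite H scale0r => /tf[].
Qed.

Local Notation bidual := (dual_module (dual_module C)).

(** Transposing [h] gives an endomorphism of the dual, which is locally free at [w1] and [w2], so
    that [scalar_endo] applies. *)
Lemma bidual_hom_scalar (h : {linear C -> bidual}) : exists t : R, forall c (d : dual_module C),
  (h c : {linear dual_module C -> R^o}) d = t * (d : {linear C -> R^o}) c.
Proof.
have tf := semidualizing_torsion_free; have rk := semidualizing_rank_le1.
have gL (d : dual_module C) : linear (fun c => (h c : {linear dual_module C -> R^o}) d : R^o).
  by move=> a x y; rewrite linearP.
have kL : linear (fun d => (mk_linear (gL d) : dual_module C)).
  by move=> a d d'; apply: Hom_eqP => c /=; rewrite linearP.
have [t tE] := scalar_endo dom w1_neq0 reg2 (mk_linear kL)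
  (@torsion_free_hom R C _ (torsion_free_regular dom))
  (locally_free1_of_dual dom noeth Cfg tf rk LD1)
  (locally_free1_of_dual dom noeth Cfg tf rk LD2).
exists t => c d.
exact: (congr1 (fun f : dual_module C => (f : {linear C -> R^o}) c) (tE d)).
Qed.

Lemma biduality_linear :
  exists ev : {linear C -> bidual}, forall c (d : dual_module C),
    (ev c : {linear dual_module C -> R^o}) d = (d : {linear C -> R^o}) c.
Proof.
have evL c : linear (fun d : dual_module C => (d : {linear C -> R^o}) c : R^o) by [].
have L : linear (fun c => (mk_linear (evL c) : bidual)).
  by move=> a x y; apply: Hom_eqP => d /=; rewrite linearP.
by exists (mk_linear L).
Qed.

Lemma semidualizing_reflexive : Ext_eq0 1 C C -> reflexive_module C.
Proof.
move=> Ext; split=> //; have [ev evE] := biduality_linear.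
have evI : injective ev.
  move=> x y E; apply/eqP; rewrite -subr_eq0; apply/eqP/biduality_inj => d.
  rewrite raddfB /= -!(evE _ (d : dual_module C)) E.
  by rewrite subrr.
exists ev; apply: bijective_inj_surj => // e0; apply: contrapT => N0.
(* The class of [e] generates a copy of [R / p] in the cokernel of [ev]. *)
have [|||||e [_ eN pP]] := @associated_prime bidual (fun e => exists c, ev c = e) (fun=> True) e0.
- by exists 0; rewrite linear0.
- by move=> a _ _ [x <-] [y <-]; exists (a *: x + y); rewrite linearP.
- by [].
- by [].
- exact: N0.
have [b [bL [c1 bc1]]] := functional_mod_prime Cfg endo_faithful pP.
pose P := free_resolution C.
(* Modulo the image of [ev], the map [b c *: e] is linear in [c]; [F] lifts it to [P 0]. *)
have [F FE] := free_lift (fun c => b c *: e : bidual).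
have [pI p1 pM] := pP; have [p0 pD pZ] := pI.
(* As [b] is linear only modulo [p], [b 0] is merely an element of [p]. *)
have b0P : exists c, ev c = b 0 *: e.
  have := bL 1 0 0; rewrite scale1r addr0 mul1r opprD addrA subrr sub0r.
  by move=> /(pZ (-1)); rewrite mulN1r opprK.
have Fb (z : P 0%N) : exists c, ev c = F z - b (res_aug P z) *: e.
  have [s [a ->]] := free_moduleE z.
  elim: s => [|x s [c cE]].
    have [c cE] := b0P; exists (- c).
    by rewrite big_nil !linear0 sub0r linearN cE.
  rewrite big_cons (linearP F) (linearP (res_aug P)) FE.
  have -> : res_aug P (free_gen R x) = x by apply: free_coverE.
  set y := res_aug P _ in cE *.
  have [c' c'E] := bL (a x) x y.
  exists (c - c'); rewrite raddfB /= cE c'E scalerBl scalerDl -scalerA.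
  rewrite opprB addrA; congr (_ - _).
  by rewrite [_ + b y *: e]addrC addrA subrK addrC.
have augd y : res_aug P (res_d P 0 y) = 0 by apply/res_exact0; exists y.
(* This cocycle is the obstruction to lifting the map from the cokernel of [ev] to the bidual. *)
have [f fE] : exists f : {linear P 1%N -> C}, forall y, ev (f y) = F (res_d P 0 y).
  apply: (@linear_choice R (P 1%N) C (fun y c => ev c = F (res_d P 0 y))).
  - move=> y; have [c cE] := Fb (res_d P 0 y); have [c' c'E] := b0P.
    by exists (c + c'); rewrite linearD /= cE augd c'E subrK.
  - by move=> y c c' <- /evI.
  - by move=> a y y' c c' E E'; rewrite !linearP /= E E'.
have fC : cocycle f.
  move=> x; apply: evI; rewrite fE linear0.
  have -> : res_d P 0 (res_d P 1 x) = 0 by apply/res_exact; exists x.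
  by rewrite linear0.
have [g gE] := Ext P f fC.
(* Since [f] is the coboundary of [g], the difference of [F] and [ev \o g] vanishes on boundaries
   and descends to [C]. *)
have [h hE] : exists h : {linear C -> bidual}, forall c, exists p,
    res_aug P p = c /\ h c = F p - ev (g p).
  apply: (@linear_choice R C bidual (fun c y => exists p,
    res_aug P p = c /\ y = F p - ev (g p))).
  - by move=> c; have [p <-] := res_aug_surj P c; exists (F p - ev (g p)), p.
  - move=> c y y' [p [pE ->]] [p' [p'E ->]].
    have /res_exact0[q qE] : res_aug P (p - p') = 0 by rewrite raddfB /= pE p'E subrr.
    have : F (p - p') = ev (g (p - p')) by rewrite -qE -gE fE.
    rewrite !raddfB /= => H; rewrite -[F p](subrK (F p')) H addrAC.
    by rewrite [_ - _ - _]addrAC subrr add0r addrC.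
  - move=> a c c' y y' [p [<- ->]] [p' [<- ->]]; exists (a *: p + p').
    split; first by rewrite linearP.
    by rewrite (linearP F) (linearP g) (linearP ev) scalerBr opprD [RHS]addrACA.
(* So [h] is [t] times [ev], which puts [b c1 *: e] in the image of [ev], against the choice of
   [c1]. *)
have [t tE] := bidual_hom_scalar h.
apply: bc1; have [p [pE hp]] := hE c1; have [c cE] := Fb p.
exists (t *: c1 + g p - c); rewrite raddfB /= linearD linearZ /= cE pE.
have -> : t *: ev c1 = F p - ev (g p).
  by rewrite -hp; apply: Hom_eqP => d /=; rewrite evE tE.
by rewrite subrK opprB addrC subrK.
Qed.

Lemma semidualizing_Cl : Ext_eq0 1 C C -> Cl (iso_class C).
Proof.
move=> Ext; exists C; split=> //; first exact: semidualizing_reflexive.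
apply/(has_rank1P semidualizing_torsion_free); split; first exact: semidualizing_rank_le1.
have [b [c bc]] := semidualizing_functional.
by exists c => c0; apply: bc; rewrite c0 linear0.
Qed.
End Semidualizing.

(** * Conclusion *)

Section DivisorClass.
Variable R : comNzRingType.
Hypothesis dom : domain R.
Hypothesis noeth : noetherian R.
Variables (w1 w2 : R) (I : finType) (w3 : I -> R).
Hypothesis w1_neq0 : w1 <> 0.
Hypothesis reg2 : forall a b x y, x * w2 ^+ b = y * w1 ^+ a -> exists z, x = z * w1 ^+ a.
Hypothesis reg3 : forall a b c x y z, (0 < c)%N ->
  x * (\sum_i w3 i ^+ c) = y * w1 ^+ a + z * w2 ^+ b ->
  exists y' z', x = y' * w1 ^+ a + z' * w2 ^+ b.
Hypothesis LD1 : least_denominators w1.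
Hypothesis LD2 : least_denominators w2.
Hypothesis LD3 : forall i, least_denominators (w3 i).

(** The dual is locally free, hence so is the bidual, to which [M] is isomorphic. *)
Lemma reflexive_locally_free1 (w : R) (M : lmodType R) :
  least_denominators w -> reflexive_module M -> rank_le1 M -> locally_free1 w M.
Proof.
move=> LD refl rk; have tf := reflexive_torsion_free dom refl.
have [fg /isomorphic_sym iso] := refl.
apply: (locally_free1_iso iso); apply: locally_free1_dual.
exact: locally_free1_of_dual.
Qed.

Lemma Cl_semidualizing (C : lmodType R) :
  finitely_generated C -> Cl (iso_class C) -> semidualizing 1 C.
Proof.
move=> fg [M [refl rkM E]].
have tfM := reflexive_torsion_free dom refl.
have [rk [x0 x00]] := (has_rank1P tfM).1 rkM.
(* The classes of [M] and [C] are equal as predicates, and the class of [C] contains [C]. *)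
have iso : isomorphic M C.
  by rewrite -[isomorphic M C]/(iso_class M C) -E; apply: isomorphic_refl.
have [f [g [fK gK]]] := isomorphicP iso.
have tf : torsion_free C.
  move=> a x H; have [||gx] := tfM a (g x); [by rewrite -linearZ H linear0 | by left |].
  by right; rewrite -[x]gK gx linear0.
have ne : exists c : C, c <> 0.
  by exists (f x0) => H; apply: x00; rewrite -[x0]fK H linear0.
have lf w : least_denominators w -> locally_free1 w C.
  by move=> LD; apply: (locally_free1_iso iso); apply: reflexive_locally_free1.
have regC a b (x y : C) : w2 ^+ b *: x = w1 ^+ a *: y -> exists z, x = w1 ^+ a *: z.
  move=> /(congr1 g); rewrite !linearZ /= => H.
  have [||z zE] := reflexive_regular dom refl rk _ _ H.
  - exact: domain_expr_neq0.
  - by move=> u v; apply: reg2.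
  by exists (f z); rewrite -linearZ -zE gK.
have sc := fun h : {linear C -> C} => scalar_endo dom w1_neq0 reg2 h tf (lf _ LD1) (lf _ LD2).
split=> //; first exact: Hom_self_isomorphic.
case=> [|[|i]] // _.
exact: (Ext1_self_eq0 dom w1_neq0 reg2 reg3 tf (lf _ LD1) (lf _ LD2) (fun i => lf _ (LD3 i)) regC).
Qed.
End DivisorClass.

Theorem mainTheorem1 (k : fieldType) (n : nat) (n_gt0 : (0 < n)%N)
    (C : lmodType (det_ring k n_gt0)) :
  finitely_generated C -> (semidualizing 1 C <-> Cl (iso_class C)).
Proof.
case: n n_gt0 C => [//|n'] n_gt0 C fg.
have w1N0 := minor1_neq0 k n'; have w2N0 := minor2_neq0 k n'.
have dom : domain (det_ring k n_gt0).
  by apply: (det_ring_domain w1N0) => N x; apply: det_ring_regular1.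
have noeth := @det_ring_noetherian k n' n_gt0.
have LD i j := @det_ring_least_denominators k n' n_gt0 i j ^~ dom.
have w1P := @det_pi_minor_neq0 k n' n_gt0 _ _ w1N0.
have reg2 := @det_ring_regular2 k n' n_gt0.
have reg3 := @det_ring_regular3 k n' n_gt0.
split=> [[_ Cend Ext]|].
  by apply: (semidualizing_Cl dom noeth fg Cend w1P reg2); [apply: LD|apply: LD|apply: Ext].
apply: (Cl_semidualizing dom noeth w1P reg2 reg3) => // [||i]; apply: LD => //.
exact: minor_diag_neq0.
Qed.
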